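(* Let $G=(V,E)$ be a connected undirected graph with $n$ vertices and $m$ edges, every vertex of weight $1$, each edge $e$ of length $l(e)>0$, and let $k\le n$ be a positive integer. Suppose the matrix of shortest-path distances between all pairs of vertices of $G$ is given. Then a partial center $x^*$ of $G$ (a point of $G$ minimizing $\phi(x,G)$) and the optimal value $\phi(x^*,G)$ can be computed in $O(mn\log n)$ time.
   Context: Each edge is regarded as a line segment of its length; a point of $G$ is a vertex or a point on an edge. For points $x,y$ of $G$, $d(x,y)$ is the shortest-path distance in $G$. A shortest path tree of a point $x$ is a tree of shortest paths from $x$ to all vertices (with $x$ a dummy root vertex if interior to an edge); a $k$-subtree is a subgraph of $G$ that is a tree with exactly $k$ vertices. Let $G^k(x)$ be the set of all $k$-subtrees of $G$ contained in some shortest path tree of $x$, and $\phi(x,G)=\min_{T^k\in G^k(x)}\max_{v\in V(T^k)} w_v d(v,x)$ with all $w_v=1$. The unweighted connected $k$-vertex one-center problem asks for a point minimizing $\phi(x,G)$. *)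

(* Defs.v *)
From mathcomp Require Import all_boot all_order all_algebra.
From mathcomp Require Import classical_sets reals.

Set Implicit Arguments.
Unset Strict Implicit.
Unset Printing Implicit Defensive.

Import Order.TTheory GRing.Theory Num.Theory.
Local Open Scope ring_scope.

(* ** Weighted graphs *)

(* An edge is the set of its two endpoints; [elen] is only meaningful on
   [edges]. *)
Record wgraph (R : Type) (V : finType) := WGraph {
  edges : {set {set V}};
  elen : {set V} -> R
}.

Definition joins (V : finType) (F : {set {set V}}) : rel V :=
  fun u v => [set u; v]%SET \in F.

Definition simple_graph (R : realType) (V : finType) (G : wgraph R V) : Prop :=
  forall e, e \in edges G -> #|e| = 2%N /\ 0 < elen G e.

Definition connected_graph (R : realType) (V : finType) (G : wgraph R V) :
    Prop :=
  forall u v : V, connect (joins (edges G)) u v.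

(* The walk starts at [u] and then visits the vertices of [p] in order. *)
Fixpoint walk_length (R : realType) (V : finType) (G : wgraph R V)
    (u : V) (p : seq V) : R :=
  if p is v :: p' then elen G [set u; v]%SET + walk_length G v p' else 0.

Definition dist (R : realType) (V : finType) (G : wgraph R V) (u v : V) : R :=
  inf [set r : R | exists p : seq V,
        [/\ path (joins (edges G)) u p, last u p = v & r = walk_length G u p]].

(* ** Trees *)

Record subgraph (V : finType) := Subgraph {
  sg_vertices : {set V};
  sg_edges : {set {set V}}
}.

Definition is_tree (V : finType) (T : subgraph V) : Prop :=
  [/\ sg_vertices T != finset.set0,
      forall f, f \in sg_edges T -> f \subset sg_vertices T,
      forall u v, u \in sg_vertices T -> v \in sg_vertices T ->
        connect (joins (sg_edges T)) u v
    & forall c : seq V, ucycle (joins (sg_edges T)) c -> (size c <= 2)%N].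

Definition is_spt (R : realType) (V : finType) (G : wgraph R V) (r : V)
    (S : {set {set V}}) : Prop :=
  [/\ S \subset edges G,
      is_tree (Subgraph [set: V]%SET S)
    & forall v : V, exists p : seq V,
        [/\ path (joins S) r p, last r p = v & walk_length G r p = dist G r v]].

Definition is_subtree (R : realType) (V : finType) (G : wgraph R V) (k : nat)
    (T : subgraph V) : Prop :=
  [/\ sg_edges T \subset edges G, is_tree T & #|sg_vertices T| = k].

(* ** Points of the graph *)

(* [EdgePoint u v t] is the point in the interior of the edge {u, v} at distance
   [t] from [u] along that edge; it is also [EdgePoint v u (elen G {u, v} - t)].
   *)
Inductive graph_point (R : Type) (V : Type) :=
  | VertexPoint of V
  | EdgePoint of V & V & R.
Arguments VertexPoint {R V}.
Arguments EdgePoint {R V}.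

Definition on_graph (R : realType) (V : finType) (G : wgraph R V)
    (x : graph_point R V) : Prop :=
  match x with
  | VertexPoint _ => True
  | EdgePoint u v t => [set u; v]%SET \in edges G /\ 0 < t < elen G [set u; v]%SET
  end.

(* The edges of the subdivided graph that make up the edge [f] of the original
   graph, when {u, v} is subdivided by the dummy vertex [None]. *)
Definition subdiv_edge (V : finType) (u v : V) (f : {set V}) :
    {set {set option V}} :=
  if f == [set u; v]%SET
  then [set [set None; Some u]; [set None; Some v]]%SET
  else [set (Some @: f)]%SET.

Definition subdiv (R : realType) (V : finType) (G : wgraph R V) (u v : V)
    (t : R) : wgraph R (option V) :=
  WGraph
    (\bigcup_(f in edges G) subdiv_edge u v f)%SET
    (fun g : {set option V} =>
       if g == [set None; Some u]%SET then t
       else if g == [set None; Some v]%SET then elen G [set u; v]%SET - t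
       else elen G (Some @^-1: g)%SET).

Definition point_dist (R : realType) (V : finType) (G : wgraph R V)
    (x : graph_point R V) (y : V) : R :=
  match x with
  | VertexPoint u => dist G u y
  | EdgePoint u v t => dist (subdiv G u v t) None (Some y)
  end.

(* A shortest path tree of an interior point of {u, v} lives in the subdivided
   graph; it contains the edge {u, v} when it contains both halves. *)
Definition in_some_spt (R : realType) (V : finType) (G : wgraph R V)
    (x : graph_point R V) (T : subgraph V) : Prop :=
  match x with
  | VertexPoint u =>
      exists S, is_spt G u S /\ sg_edges T \subset S
  | EdgePoint u v t =>
      exists S, is_spt (subdiv G u v t) None S /\
        forall f, f \in sg_edges T -> subdiv_edge u v f \subset S
  end.

Definition subtrees_at (R : realType) (V : finType) (G : wgraph R V) (k : nat)
    (x : graph_point R V) : set (subgraph V) :=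
  [set T | is_subtree G k T /\ in_some_spt G x T]%classic.

(* The default value 0 of the maximum is harmless: weights and distances are
   nonnegative. *)
Definition radius (R : realType) (V : finType) (G : wgraph R V) (w : V -> R)
    (x : graph_point R V) (T : subgraph V) : R :=
  \big[Num.max/0]_(v in sg_vertices T) (w v * point_dist G x v).

(* An infimum over a finite set, hence a minimum: in a connected graph with at
   least k vertices the set is nonempty. *)
Definition phi (R : realType) (V : finType) (G : wgraph R V) (w : V -> R)
    (k : nat) (x : graph_point R V) : R :=
  inf [set radius G w x T | T in subtrees_at G k x]%classic.

Definition partial_center (R : realType) (V : finType) (G : wgraph R V)
    (w : V -> R) (k : nat) (x : graph_point R V) : Prop :=
  on_graph G x /\ forall y, on_graph G y -> phi G w k x <= phi G w k y.

(* ** Real random access machine *)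

Local Close Scope ring_scope.

(* The memory consists of arrays of naturals and arrays of reals.  Array names
   are literals of the program, indices are computed.  Every operation on
   naturals or reals, every memory access and every test has unit cost.
   Naturals only have addition and (truncated) subtraction, as in the usual
   unit-cost random access machine, and there is no conversion from reals to
   naturals. *)
Inductive iexp :=
  | IConst of nat
  | IGet of nat & iexp
  | IAdd of iexp & iexp
  | ISub of iexp & iexp.

Inductive rexp :=
  | RConst of nat
  | RGet of nat & iexp
  | RAdd of rexp & rexp
  | RSub of rexp & rexp
  | RMul of rexp & rexp
  | RDiv of rexp & rexp.

Inductive bexp :=
  | BILe of iexp & iexp
  | BRLe of rexp & rexp
  | BNot of bexp
  | BAnd of bexp & bexp.

Inductive cmd :=
  | Skip
  | ISet of nat & iexp & iexp
  | RSet of nat & iexp & rexp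
  | Seq of cmd & cmd
  | If of bexp & cmd & cmd
  | While of bexp & cmd.

Record state (R : Type) := State {
  imem : nat -> nat -> nat;
  rmem : nat -> nat -> R
}.

Definition update (T : Type) (f : nat -> nat -> T) (a i : nat) (y : T) :
    nat -> nat -> T :=
  fun a' i' => if (a' == a) && (i' == i) then y else f a' i'.

Section Semantics.
Variable R : realType.
Implicit Types s : state R.

Fixpoint ieval s (e : iexp) : nat :=
  match e with
  | IConst c => c
  | IGet a i => imem s a (ieval s i)
  | IAdd e1 e2 => (ieval s e1 + ieval s e2)
  | ISub e1 e2 => (ieval s e1 - ieval s e2)
  end.

Fixpoint reval s (e : rexp) : R :=
  match e with
  | RConst c => c%:R%R
  | RGet a i => rmem s a (ieval s i)
  | RAdd e1 e2 => (reval s e1 + reval s e2)%R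
  | RSub e1 e2 => (reval s e1 - reval s e2)%R
  | RMul e1 e2 => (reval s e1 * reval s e2)%R
  | RDiv e1 e2 => (reval s e1 / reval s e2)%R
  end.

Fixpoint beval s (b : bexp) : bool :=
  match b with
  | BILe e1 e2 => (ieval s e1 <= ieval s e2)
  | BRLe e1 e2 => (reval s e1 <= reval s e2)%R
  | BNot b1 => ~~ beval s b1
  | BAnd b1 b2 => beval s b1 && beval s b2
  end.

Fixpoint icost (e : iexp) : nat :=
  match e with
  | IConst _ => 1
  | IGet _ i => (icost i).+1
  | IAdd e1 e2 | ISub e1 e2 => (icost e1 + icost e2).+1
  end.

Fixpoint rcost (e : rexp) : nat :=
  match e with
  | RConst _ => 1
  | RGet _ i => (icost i).+1
  | RAdd e1 e2 | RSub e1 e2 | RMul e1 e2 | RDiv e1 e2 =>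
      (rcost e1 + rcost e2).+1
  end.

Fixpoint bcost (b : bexp) : nat :=
  match b with
  | BILe e1 e2 => (icost e1 + icost e2).+1
  | BRLe e1 e2 => (rcost e1 + rcost e2).+1
  | BNot b1 => (bcost b1).+1
  | BAnd b1 b2 => (bcost b1 + bcost b2).+1
  end.

(* [exec c s s' t]: started in [s], the command [c] halts in [s'] after time
   [t]. *)
Inductive exec : cmd -> state R -> state R -> nat -> Prop :=
  | ExecSkip s : exec Skip s s 1
  | ExecISet s a i e :
      exec (ISet a i e) s
        (State (update (imem s) a (ieval s i) (ieval s e)) (rmem s))
        (icost i + icost e).+1
  | ExecRSet s a i e :
      exec (RSet a i e) s
        (State (imem s) (update (rmem s) a (ieval s i) (reval s e)))
        (icost i + rcost e).+1
  | ExecSeq c1 c2 s s1 s2 t1 t2 :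
      exec c1 s s1 t1 -> exec c2 s1 s2 t2 ->
      exec (Seq c1 c2) s s2 (t1 + t2)
  | ExecIfTrue b c1 c2 s s1 t :
      beval s b -> exec c1 s s1 t ->
      exec (If b c1 c2) s s1 (bcost b + t).+1
  | ExecIfFalse b c1 c2 s s1 t :
      ~~ beval s b -> exec c2 s s1 t ->
      exec (If b c1 c2) s s1 (bcost b + t).+1
  | ExecWhileFalse b c s :
      ~~ beval s b -> exec (While b c) s s (bcost b).+1
  | ExecWhileTrue b c s s1 s2 t1 t2 :
      beval s b -> exec c s s1 t1 -> exec (While b c) s1 s2 t2 ->
      exec (While b c) s s2 (bcost b + t1 + t2).+1.

End Semantics.

(* ** Input and output *)

(* [es] lists every edge exactly once, in any order and with any orientation. *)
Definition edge_list (R : realType) (V : finType) (G : wgraph R V)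
    (es : seq (V * V)) : Prop :=
  perm_eq [seq [set p.1; p.2]%SET | p <- es] (enum (edges G)).

(* Natural arrays: 0 holds n, m, k; 1 and 2 hold the endpoints of the edges.
   Real arrays: 0 holds the distance matrix in row-major order; 1 holds the
   edge lengths.  All other cells are 0. *)
Definition input (R : realType) (n : nat) (G : wgraph R 'I_n) (k : nat)
    (es : seq ('I_n * 'I_n)) : state R :=
  State
    (fun a i => nth 0 (nth [::]
       [:: [:: n; #|edges G|; k];
           [seq val p.1 | p <- es];
           [seq val p.2 | p <- es]] a) i)
    (fun a i => nth 0%R (nth [::]
       [:: [seq dist G u v | u <- enum 'I_n, v <- enum 'I_n];
           [seq elen G [set p.1; p.2]%SET | p <- es]] a) i).

(* The result is read from natural array 3 and real array 2: cell 0 of the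
   former is 0 for a vertex and 1 for an interior point of an edge, its next
   cells hold the vertex, or the endpoints of the edge; the latter holds the
   value at 0 and the offset of an interior point at 1. *)
Definition outputs (R : realType) (n : nat) (s : state R)
    (x : graph_point R 'I_n) (value : R) : Prop :=
  rmem s 2 0 = value /\
  match x with
  | VertexPoint u => imem s 3 0 = 0 /\ imem s 3 1 = u
  | EdgePoint u v t =>
      [/\ imem s 3 0 = 1%N, imem s 3 1 = u, imem s 3 2 = v & rmem s 2 1 = t]
  end.

(* Main.v *)
(* With unit weights, the k vertices closest to x (ties broken arbitrarily) are
   closed under taking parents in a shortest path tree of x, hence span a k-subtree.
   So phi(x) is the k-th smallest distance from x to a vertex.  At offset t on an
   edge {u, v} of length l the distance to y is min (t + a_y, l - t + b_y), where
   a_y = d(u, y) and b_y = d(v, y).  If i vertices have t + a_y <= phi(x) and j have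
   l - t + b_y <= phi(x), the point where t + a and l - t + b meet, for a the i-th
   smallest a_y and b the j-th smallest b_y, is at least as good as x; when that
   point falls outside the edge, the triangle inequality shows that an endpoint is.
   After sorting both lists in O(n log n), a staircase walk finds in O(n) steps, for
   every i, the least j such that the two prefixes together contain k vertices. *)

From mathcomp Require Import classical_sets.
Require Import Defs.
From mathcomp Require Import all_boot all_order all_algebra.
From mathcomp Require Import reals.
From mathcomp Require Import zify ring lra.

Set Implicit Arguments.
Unset Strict Implicit.
Unset Printing Implicit Defensive.
Import Order.TTheory GRing.Theory Num.Theory.

(** * Shortest paths *)

(** All comparisons go through thresholds: [phi] of a point is at most c exactly when k vertices lie
    within c of it, so every claim about values becomes a count. The two prefixes of a pair (i, j)
    may overlap, and the meeting point may have further vertices within the meeting value; a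
    candidate value therefore only bounds the value of its point from above. Accordingly two
    one-sided facts are maintained: the recorded point is no worse than the recorded number, and
    that number is at most the value of every point on the edges treated so far. Equality appears
    only after the last edge. Storing the inverse of each sorted order makes the size of the union
    of two prefixes updatable in constant time when one prefix gains or loses a vertex, which keeps
    the walk linear. Both rows are sorted afresh for every edge; at O(n log n) per edge this stays
    within the bound. The successor in the time bound is for the one-vertex graph, where m n log n
    vanishes. *)

Section ShortestPaths.
Local Open Scope ring_scope.
Variables (R : realType) (V : finType) (G : wgraph R V).
Hypotheses (Gs : simple_graph G) (Gc : connected_graph G).
Implicit Types (u v w r : V) (p : seq V).

Lemma joins_sym (F : {set {set V}}) : symmetric (joins F).
Proof. by move=> u v; rewrite /joins finset.setUC. Qed.

Lemma joins_neq u v : joins (edges G) u v -> u != v.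
Proof. by case/Gs; rewrite cards2; case: eqP. Qed.

Lemma joins_len_gt0 u v : joins (edges G) u v -> 0 < elen G [set u; v]%SET.
Proof. by case/Gs. Qed.

Lemma walk_length_ge0 u p : path (joins (edges G)) u p -> 0 <= walk_length G u p.
Proof.
elim: p u => [|v p IH] u //= /andP[uv /IH vp].
by rewrite addr_ge0 // ltW // joins_len_gt0.
Qed.

Lemma walk_length_rcons u p v :
  walk_length G u (rcons p v) = walk_length G u p + elen G [set last u p; v]%SET.
Proof. by elim: p u => [|w p IH] u /=; rewrite ?addr0 ?add0r // IH addrA. Qed.

Let walks u v := [set r : R | exists p : seq V,
  [/\ path (joins (edges G)) u p, last u p = v & r = walk_length G u p]]%classic.

Let walks_neq0 u v : (walks u v !=set0)%classic.
Proof.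
have /connectP[p up pv] := Gc u v.
by exists (walk_length G u p); exists p; split.
Qed.

Lemma dist_le_walk u p :
  path (joins (edges G)) u p -> dist G u (last u p) <= walk_length G u p.
Proof.
move=> up; apply: ge_inf; last by exists p.
by exists 0 => _ [q [uq _ ->]]; apply: walk_length_ge0.
Qed.

Lemma le_dist u v (c : R) :
  (forall p, path (joins (edges G)) u p -> last u p = v -> c <= walk_length G u p) ->
  c <= dist G u v.
Proof.
by move=> H; apply: lb_le_inf; [exact: walks_neq0|move=> _ [p [up pv ->]]; apply: H].
Qed.

Lemma dist_ge0 u v : 0 <= dist G u v.
Proof. by apply: le_dist => p up _; apply: walk_length_ge0. Qed.

Lemma dist_refl u : dist G u u = 0.
Proof. by apply/le_anti; rewrite dist_ge0 (@dist_le_walk u [::]). Qed.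

Lemma dist_edge_r r u v : joins (edges G) u v ->
  dist G r v <= dist G r u + elen G [set u; v]%SET.
Proof.
move=> uv; rewrite -lerBlDr; apply: le_dist => p rp pu.
rewrite lerBlDr -pu -walk_length_rcons.
have := @dist_le_walk r (rcons p v); rewrite last_rcons; apply.
by rewrite rcons_path rp pu.
Qed.

Lemma dist_edge_l r u v : joins (edges G) u v ->
  dist G u r <= elen G [set u; v]%SET + dist G v r.
Proof.
move=> uv; rewrite -lerBlDl; apply: le_dist => p vp pr.
rewrite lerBlDl -pr; apply: (@dist_le_walk u (v :: p)); by rewrite /= uv.
Qed.

(** Distance is an infimum over infinitely many walks, but each walk to v ends with one of finitely
    many edges, so the best last edge attains it. The conclusion is informative, which makes
    [parent] a function. *)
Lemma dist_parent r v : v != r ->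
  {z | joins (edges G) z v & dist G r v = dist G r z + elen G [set z; v]%SET}.
Proof.
move=> vr; pose P z := joins (edges G) z v.
have [z0 Pz0] : {z0 | P z0}.
  apply: sigW; have /connectP[p] := Gc r v.
  case/lastP: p => [|p z] /=; first by move=> _ vr'; rewrite vr' eqxx in vr.
  by rewrite rcons_path last_rcons => /andP[_ pz] vz; exists (last r p); rewrite /P vz.
pose f z := dist G r z + elen G [set z; v]%SET.
case: (Order.TotalTheory.arg_minP f Pz0) => z Pz zmin; exists z => //.
apply/le_anti; rewrite dist_edge_r //=; apply: le_dist => p.
case/lastP: p => [|p y] /=; first by move=> _ vr'; rewrite vr' eqxx in vr.
rewrite rcons_path last_rcons => /andP[rp py] yv; subst y.
rewrite walk_length_rcons; apply: (le_trans (zmin (last r p) py)).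
by rewrite lerD2r dist_le_walk.
Qed.

Lemma dist_eq0 u v : dist G u v = 0 -> u = v.
Proof.
apply: contra_eq => uv; have [|z zv ->] := @dist_parent u v; first by rewrite eq_sym.
by rewrite gt_eqF // ltr_wpDl ?dist_ge0 ?joins_len_gt0.
Qed.

Definition parent r v : option V :=
  if eqVneq v r is NeqNotEq vr then Some (s2val (dist_parent vr)) else None.

Lemma parent_edge r v z : parent r v = Some z ->
  joins (edges G) z v /\ dist G r v = dist G r z + elen G [set z; v]%SET.
Proof. by rewrite /parent; case: eqVneq => // vr [<-]; case: dist_parent. Qed.

Lemma parent_lt r v z : parent r v = Some z -> dist G r z < dist G r v.
Proof. by case/parent_edge=> /joins_len_gt0 l0 ->; rewrite ltrDl. Qed.

Lemma parentN r v : (parent r v == None) = (v == r).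
Proof. by rewrite /parent; case: eqVneq. Qed.

End ShortestPaths.

(** * Shortest path trees *)

Section Trees.
Local Open Scope ring_scope.
Variables (R : realType).

Lemma eq_set2 (T : finType) (a b c d : T) : [set a; b]%SET = [set c; d]%SET ->
  (a = c /\ b = d) \/ (a = d /\ b = c).
Proof.
move=> E.
have: a \in [set c; d]%SET by rewrite -E set21.
have: b \in [set c; d]%SET by rewrite -E set22.
have: c \in [set a; b]%SET by rewrite E set21.
have: d \in [set a; b]%SET by rewrite E set22.
by do 4![case/set2P=> ?]; subst; auto.
Qed.

(** Real ranks are not well-founded, but on a finite type the number of elements of smaller rank
    decreases. *)
Lemma rank_ind (V : finType) (rk : V -> R) (P : V -> Prop) :
  (forall v, (forall w, rk w < rk v -> P w) -> P v) -> forall v, P v.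
Proof.
move=> H v; have [n] := ubnP #|[set w | rk w < rk v]%SET|.
elim: n v => // n IH v lt; apply: H => w wv; apply: IH.
rewrite ltnS in lt.
apply: leq_trans _ lt; apply: proper_card; apply/properP; split.
  by apply/fintype.subsetP => x; rewrite !inE => /lt_trans; apply.
by exists w; rewrite !inE ?ltxx.
Qed.

Definition parent_edges (V : finType) (W : {set V}) (r : V) (par : V -> V) :
  {set {set V}} := [set [set par v; v]%SET | v in W :\ r]%SET.

(* On a cycle the vertex of largest rank would have its parent as both
   neighbours. *)
Lemma parent_tree (V : finType) (W : {set V}) (r : V) (par : V -> V)
    (rk : V -> R) :
  r \in W ->
  (forall v, v \in W -> v != r -> par v \in W /\ rk (par v) < rk v) ->
  is_tree (Subgraph W (parent_edges W r par)).
Proof.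
move=> rW parP; set F := parent_edges W r par.
have toroot : forall v, v \in W -> connect (joins F) r v.
  elim/(rank_ind (rk := rk)) => v IH vW; have [->//|vr] := eqVneq v r.
  have [pW lt] := parP v vW vr; apply: connect_trans (IH _ lt pW) _.
  by apply: connect1; apply/imsetP; exists v => //; rewrite !inE vr.
have up x y : joins F x y -> rk y <= rk x -> y = par x.
  case/imsetP=> v; rewrite !inE => /andP[vr vW] /eq_set2[[-> ->]|[-> ->]] //.
  by have [_ lt] := parP v vW vr; rewrite leNgt lt.
split=> /= [|f|x y xW yW|c /andP[cc cu]].
- by apply/set0Pn; exists r.
- case/imsetP=> v; rewrite !inE => /andP[vr vW] ->.
  by rewrite subUset !sub1set vW (parP v vW vr).1.
- apply: connect_trans (toroot y yW).
  by rewrite (sym_connect_sym (@joins_sym _ F)) toroot.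
- rewrite leqNgt; apply/negP => c3.
  have [x0 x0c] : exists x0, x0 \in c.
    by case: c c3 {cc cu} => // x0 c _; exists x0; rewrite mem_head.
  case: (Order.TotalTheory.arg_maxP rk x0c) => x xc xmax.
  have [i p rotE] := rot_to xc.
  have xm y : y \in x :: p -> rk y <= rk x by rewrite -rotE mem_rot => /xmax.
  move: cc cu c3; rewrite -(rot_cycle i) -(rot_uniq i) -(size_rot i) rotE.
  case: p {rotE} xm => // y p; case/lastP: p => // p z xm /= /andP[xy].
  rewrite rcons_path last_rcons => /andP[_ zx] /andP[_ /andP[yp _]] _.
  have yx : y = par x by apply: up xy _; apply: xm; rewrite !inE eqxx orbT.
  have zpx : z = par x.
    apply: up; first by rewrite joins_sym.
    by apply: xm; rewrite !inE mem_rcons mem_head !orbT.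
  by rewrite yx -zpx mem_rcons mem_head in yp.
Qed.

Lemma closest_set (V : finType) (d : V -> R) k : (k <= #|V|)%N ->
  exists W : {set V}, #|W| = k /\ forall y z, y \in W -> z \notin W -> d y <= d z.
Proof.
elim: k => [_|k IH kn].
  by exists finset.set0; rewrite cards0; split=> // y z; rewrite inE.
have [W [Wk cl]] := IH (ltnW kn).
have [x0 x0W] : exists x0, x0 \in ~: W.
  by apply/set0Pn; rewrite -card_gt0 cardsCs finset.setCK Wk subn_gt0.
case: (Order.TotalTheory.arg_minP d x0W) => x xCW xmin.
have xW : x \notin W by have : x \in ~: W := xCW; rewrite inE.
exists (x |: W)%SET; rewrite cardsU1 xW Wk; split=> // y z.
rewrite !inE negb_or => /orP[/eqP -> | yW] /andP[_ zW]; last exact: cl.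
have zCW : z \in ~: W by rewrite inE.
exact: xmin zCW.
Qed.

(** If a member of W were farther than c, so would be everything outside W, and the vertices within
    c would form a proper subset of W, too small for the count. *)
Lemma closest_le (V : finType) (d : V -> R) (W : {set V}) c :
  (forall y z, y \in W -> z \notin W -> d y <= d z) ->
  (#|W| <= #|[set y | (d y <= c)%R]%SET|)%N -> forall y, y \in W -> d y <= c.
Proof.
move=> cl le y yW; rewrite leNgt; apply/negP => cy.
have: [set y | (d y <= c)%R]%SET \proper W.
  apply/properP; split; last by exists y => //; rewrite inE -ltNge.
  apply/fintype.subsetP => z; rewrite inE => zc; apply: contraLR cy => zW.
  by rewrite -leNgt (le_trans (cl _ _ yW zW)).
by move/proper_card; rewrite ltnNge le.
Qed.

Lemma spt_parent (V : finType) (G : wgraph R V) (Gs : simple_graph G)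
    (Gc : connected_graph G) r :
  is_spt G r (parent_edges [set: V]%SET r (fun v => odflt r (parent Gs Gc r v))).
Proof.
set par := fun v => _.
have parP v : v != r -> parent Gs Gc r v = Some (par v).
  by rewrite /par; case E: parent => //; move/eqP: E; rewrite parentN => ->.
split.
- apply/fintype.subsetP => f /imsetP[v]; rewrite !inE andbT => vr ->.
  by have [] := parent_edge (parP v vr).
- apply: (parent_tree (rk := dist G r)) => [|v _ vr]; first by rewrite inE.
  by rewrite inE; split=> //; apply: parent_lt (parP v vr).
- elim/(rank_ind (rk := dist G r)) => v IH.
  have [->|vr] := eqVneq v r; first by exists [::]; rewrite dist_refl.
  have [vz dv] := parent_edge (parP v vr).
  have [p [rp pv pl]] := IH _ (parent_lt (parP v vr)).
  exists (rcons p v); rewrite rcons_path last_rcons walk_length_rcons rp pv pl dv.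
  split=> //=; apply/imsetP; exists v => //; by rewrite !inE vr.
Qed.
End Trees.

(** * Distances from an interior point of an edge *)

Section Subdivision.
Local Open Scope ring_scope.
Variables (R : realType) (V : finType) (G : wgraph R V).
Hypotheses (Gs : simple_graph G) (Gc : connected_graph G).
Variables (u v : V) (t : R).
Hypothesis uv : joins (edges G) u v.
Let l := elen G [set u; v]%SET.
Hypothesis tl : 0 < t < l.
Let H := subdiv G u v t.

Let u_neq_v : u != v. Proof. exact: joins_neq uv. Qed.

Lemma set2_Some (y z : V) : (Some @: [set y; z] = [set Some y; Some z])%SET.
Proof. by rewrite imsetU !imset_set1. Qed.

Lemma joins_subdiv_None y : joins (edges H) None (Some y) = (y == u) || (y == v).
Proof.
apply/bigcupP/idP => [[f fG]|yuv].
  rewrite /subdiv_edge; case: eqP => _; rewrite !inE.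
    by case/orP=> /eqP/eq_set2[[_ [->]]|[]] //; rewrite eqxx ?orbT.
  by move=> /eqP/setP/(_ None); rewrite !inE /= => /esym/imsetP[].
exists [set u; v]%SET => //; rewrite /subdiv_edge eqxx !inE.
by case/orP: yuv => /eqP ->; rewrite eqxx ?orbT.
Qed.

Lemma joins_subdiv_Some y z : joins (edges H) (Some y) (Some z) =
  joins (edges G) y z && ([set y; z]%SET != [set u; v]%SET).
Proof.
apply/bigcupP/andP => [[f fG]|[yz ne]].
  rewrite /subdiv_edge; case: eqP => [_|ne]; rewrite !inE.
    by case/orP=> /eqP/setP/(_ None); rewrite !inE.
  move=> /eqP; rewrite -set2_Some => /(imset_inj (@Some_inj _)) E.
  by rewrite /joins E; split=> //; apply/eqP.
by exists [set y; z]%SET => //; rewrite /subdiv_edge (negPf ne) inE set2_Some.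
Qed.

Lemma elen_subdiv_u : elen H [set None; Some u]%SET = t.
Proof. by rewrite /H /= eqxx. Qed.

Lemma elen_subdiv_v : elen H [set None; Some v]%SET = l - t.
Proof.
rewrite /H /= eqxx ifN //; apply/eqP => /eq_set2[[_ [vu]]|[]] //.
by move: u_neq_v; rewrite vu eqxx.
Qed.

Lemma elen_subdiv_Some y z :
  elen H [set Some y; Some z]%SET = elen G [set y; z]%SET.
Proof.
have N x : ([set Some y; Some z]%SET == [set None; Some x]%SET :> {set option V}) = false.
  by apply/eqP => /setP/(_ None); rewrite !inE.
rewrite /H /= !N; congr elen; apply/setP => x; by rewrite !inE.
Qed.

Lemma subdiv_simple : simple_graph H.
Proof.
move=> e /bigcupP[f fG]; rewrite /subdiv_edge.
have [f2 fl] := Gs fG; case: eqP => [_|/eqP fuv]; rewrite !inE.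
  by case/andP: tl => t0 tl'; case/orP=> /eqP ->;
    rewrite cards2 ?elen_subdiv_u ?elen_subdiv_v ?subr_gt0.
move=> /eqP ->; rewrite card_imset; last exact: Some_inj.
have /cards2P[y [z [yz E]]] : #|f| == 2%N by rewrite f2.
by rewrite {2}E set2_Some elen_subdiv_Some -E.
Qed.

Lemma subdiv_connected : connected_graph H.
Proof.
have sym := sym_connect_sym (@joins_sym _ (edges H)).
have Nu : connect (joins (edges H)) None (Some u).
  by rewrite connect1 // joins_subdiv_None eqxx.
have Nv : connect (joins (edges H)) None (Some v).
  by rewrite connect1 // joins_subdiv_None eqxx orbT.
have N y : connect (joins (edges H)) None (Some y).
  have /connectP[p up ->] := Gc u y.
  suff: forall x, connect (joins (edges H)) None (Some x) -> path (joins (edges G)) x p ->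
    connect (joins (edges H)) None (Some (last x p)) by apply.
  elim: p {up} => [//|z p IH] x Nx /andP[xz zp]; apply: IH zp.
  have [/eq_set2[[_ ->]|[_ ->]]//|ne] := eqVneq [set x; z]%SET [set u; v]%SET.
  by apply: connect_trans Nx (connect1 _); rewrite joins_subdiv_Some; apply/andP.
have N' y : connect (joins (edges H)) None y by case: y.
by move=> x y; apply: connect_trans (N' y); rewrite sym.
Qed.

Let Hs := subdiv_simple.
Let Hc := subdiv_connected.
(** The formula to be proved for the distance from the dummy vertex, used as a potential: since it
    grows along an edge by at most the length of the edge, no walk can be shorter than it. *)
Let f (y : option V) : R :=
  if y is Some z then Num.min (t + dist G u z) (l - t + dist G v z) else 0.

Let f_edge x y : joins (edges H) x y -> f y <= f x + elen H [set x; y]%SET.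
Proof.
have [t0 tl'] := andP tl.
have fz z : 0 <= f (Some z).
  by rewrite /= le_min; have := dist_ge0 Gs Gc u z; have := dist_ge0 Gs Gc v z; lra.
case: x y => [x|] [y|].
- rewrite joins_subdiv_Some elen_subdiv_Some => /andP[xy _] /=.
  have := dist_edge_r Gs Gc u xy; have := dist_edge_r Gs Gc v xy.
  move=> ? ?; rewrite -lerBlDr le_min.
  by apply/andP; split; rewrite lerBlDr ge_min; apply/orP; [left|right]; lra.
- rewrite joins_sym joins_subdiv_None finset.setUC => /orP[] /eqP ->;
    rewrite ?elen_subdiv_u ?elen_subdiv_v; have := fz u; have := fz v; rewrite /f; lra.
- rewrite joins_subdiv_None => /orP[] /eqP ->;
    rewrite ?elen_subdiv_u ?elen_subdiv_v /= dist_refl // !addr0 add0r ge_min lexx ?orbT //.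
- by move/(joins_neq Hs); rewrite eqxx.
Qed.

Lemma dist_subdiv y : dist H None (Some y) =
  Num.min (t + dist G u y) (l - t + dist G v y).
Proof.
have [t0 tl'] := andP tl.
have Nu : dist H None (Some u) <= t.
  have := @dist_edge_r _ _ H Hs Hc None None (Some u).
  by rewrite joins_subdiv_None eqxx dist_refl // add0r elen_subdiv_u; apply.
have Nv : dist H None (Some v) <= l - t.
  have := @dist_edge_r _ _ H Hs Hc None None (Some v).
  by rewrite joins_subdiv_None eqxx orbT dist_refl // add0r elen_subdiv_v; apply.
have lift x p : path (joins (edges G)) x p ->
    dist H None (Some (last x p)) <= dist H None (Some x) + walk_length G x p.
  elim: p x => [|z p IH] x /=; first by rewrite addr0.
  case/andP=> xz /IH le; apply: le_trans le _; rewrite addrA lerD2r.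
  (* The edge {u, v} does not survive the subdivision, but its length l already pays for reaching
     either end directly from the dummy vertex. *)
  have [E|ne] := eqVneq [set x; z]%SET [set u; v]%SET.
    have := dist_ge0 Hs Hc None (Some x); rewrite E -/l.
    by have [[_ ->]|[_ ->]] := eq_set2 E; lra.
  have := @dist_edge_r _ _ H Hs Hc None (Some x) (Some z).
  by rewrite elen_subdiv_Some joins_subdiv_Some xz ne; apply.
apply/le_anti/andP; split.
  rewrite le_min; apply/andP; split; rewrite addrC -lerBlDr; apply: le_dist => // p up <-;
    by have := lift _ _ up; lra.
suff low x p : path (joins (edges H)) x p -> f (last x p) <= f x + walk_length H x p.
  by apply: (le_dist Hc) => p Np pl; have := low _ _ Np; rewrite pl /= add0r.
elim: p x => [|z p IH] x /=; first by rewrite addr0.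
by case/andP=> /f_edge xz /IH le; rewrite addrA; apply: le_trans le _; rewrite lerD2r.
Qed.

End Subdivision.

(** * The value of a point *)

Section Radius.
Local Open Scope ring_scope.
Variables (R : realType) (V : finType) (G : wgraph R V).
Hypotheses (Gs : simple_graph G) (Gc : connected_graph G).

Lemma closest_subtree_vertex k r : (0 < k <= #|V|)%N -> exists T,
  subtrees_at G k (VertexPoint r) T /\
  forall y z, y \in sg_vertices T -> z \notin sg_vertices T ->
    dist G r y <= dist G r z.
Proof.
case/andP=> k0 kn; have [W [Wk cl]] := closest_set (dist G r) kn.
pose par v := odflt r (parent Gs Gc r v).
have parP v : v != r -> parent Gs Gc r v = Some (par v).
  by rewrite /par; case E: parent => //; move/eqP: E; rewrite parentN => ->.
(* Only r has distance 0, so a nonempty closest set cannot omit it. *)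
have rW : r \in W.
  apply: contraT => rW; have /set0Pn[y yW] : W != finset.set0 by rewrite -card_gt0 Wk.
  have := cl y r yW rW; rewrite (dist_refl Gs Gc) => y0.
  have ry : r = y by apply: (dist_eq0 Gs Gc); apply/le_anti; rewrite y0 dist_ge0.
  by rewrite ry yW in rW.
have parW v : v \in W -> v != r -> par v \in W /\ dist G r (par v) < dist G r v.
  move=> vW vr; have lt := parent_lt (parP v vr); split=> //.
  by apply: contraLR lt => pW; rewrite -leNgt cl.
exists (Subgraph W (parent_edges W r par)); split=> //; split.
  split=> //=; last exact: (parent_tree rW parW).
  apply/fintype.subsetP => f /imsetP[v]; rewrite !inE => /andP[vr _] ->.
  by have [] := parent_edge (parP v vr).
exists (parent_edges [set: V]%SET r par); split; first exact: spt_parent.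
by rewrite imsetS // finset.setSD // subsetT.
Qed.

(** The dummy vertex is not a vertex of the subtree, so a child r of it takes over as root. The only
    other possible child is the opposite end of the edge; it is hung below r by {u, v}, both halves
    of which then lie in the shortest path tree. *)
Lemma closest_subtree_edge k u v (t : R) : joins (edges G) u v ->
  0 < t < elen G [set u; v]%SET -> (0 < k <= #|V|)%N -> exists T,
  subtrees_at G k (EdgePoint u v t) T /\
  forall y z, y \in sg_vertices T -> z \notin sg_vertices T ->
    point_dist G (EdgePoint u v t) y <= point_dist G (EdgePoint u v t) z.
Proof.
move=> uv tl /andP[k0 kn]; set x := EdgePoint u v t.
pose d := point_dist G x.
have [W [Wk cl]] := closest_set d kn.
pose Hs := subdiv_simple Gs uv tl; pose Hc := subdiv_connected Gc t uv.
pose par y := parent Hs Hc None (Some y).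
have parN y : par y <> None by move/eqP; rewrite parentN.
have par_lt y z : par y = Some (Some z) -> d z < d y by apply: parent_lt.
have d_gt0 y : 0 < d y.
  rewrite lt_neqAle /d /x /= (dist_ge0 Hs Hc) andbT.
  by apply/negP => /eqP/esym/(dist_eq0 Hs Hc).
have par_closed y z : y \in W -> par y = Some (Some z) -> z \in W.
  by move=> yW /par_lt; apply: contraLR => zW; rewrite -leNgt cl.
(* W is closed under parents in G and parents are strictly nearer, so the parent of a nearest member
   of W can only be the dummy vertex. *)
have [r rW rpar] : exists2 r, r \in W & par r = Some None.
  have /set0Pn[y0 y0W] : W != finset.set0 by rewrite -card_gt0 Wk.
  case: (Order.TotalTheory.arg_minP d y0W) => r rW rmin; exists r => //.
  case E: (par r) => [[z|]|] //; last by case/parN: E.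
  by have := rmin z (par_closed r z rW E); rewrite leNgt (par_lt r z E).
have par_uv y : par y = Some None -> (y == u) || (y == v).
  by case/parent_edge; rewrite (joins_subdiv_None _ uv).
have root_edge y : y != r -> par y = Some None -> [set r; y]%SET = [set u; v]%SET.
  move=> yr /par_uv; have := par_uv r rpar.
  case/orP=> /eqP re /orP[] /eqP ye; move: yr; rewrite re ye ?eqxx // => _.
  exact: finset.setUC.
pose par' y := if par y is Some (Some z) then z else r.
exists (Subgraph W (parent_edges W r par')); split=> //; split.
  split=> //=.
    apply/fintype.subsetP => f /imsetP[y]; rewrite !inE => /andP[yr _] ->.
    rewrite /par'; case E: (par y) => [[z|]|]; last by case/parN: E.
      by case/parent_edge: E; rewrite joins_subdiv_Some // => /andP[].
    by rewrite root_edge.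
  (* The root gets rank 0 instead of its distance because the other end of the edge may be equally
     near. *)
  apply: (parent_tree (rk := fun y => if y == r then 0 else d y)) => // y yW yr.
  rewrite (negPf yr) /par'; case E: (par y) => [[z|]|]; last by case/parN: E.
    rewrite (par_closed y z) //; split=> //.
    by case: eqP => // _; apply: par_lt.
  by rewrite eqxx.
exists (parent_edges [set: option V]%SET None (fun y => odflt None (parent Hs Hc None y))).
split; first exact: spt_parent.
have inS y z : par y = Some z ->
    [set z; Some y]%SET \in parent_edges [set: option V]%SET None
      (fun y => odflt None (parent Hs Hc None y)).
  by move=> E; apply/imsetP; exists (Some y); rewrite ?inE //= -/(par y) E.
move=> f /imsetP[y]; rewrite !inE => /andP[yr _] ->.
rewrite /par'; case E: (par y) => [[z|]|]; last by case/parN: E.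
  have [] := parent_edge E; rewrite joins_subdiv_Some // => /andP[_ ne] _.
  by rewrite /subdiv_edge (negPf ne) sub1set set2_Some inS.
have E2 := root_edge y yr E; rewrite /subdiv_edge E2 eqxx subUset !sub1set.
move: (inS _ _ rpar) (inS _ _ E); move: (parent_edges _ _ _) => S.
by have [[<- <-]|[<- <-]] := eq_set2 E2 => -> ->.
Qed.

Lemma closest_subtree k x : on_graph G x -> (0 < k <= #|V|)%N -> exists T,
  subtrees_at G k x T /\
  forall y z, y \in sg_vertices T -> z \notin sg_vertices T ->
    point_dist G x y <= point_dist G x z.
Proof.
case: x => [r _|u v t [uv tl]]; first exact: closest_subtree_vertex.
exact: closest_subtree_edge.
Qed.

Lemma point_dist_ge0 x y : on_graph G x -> 0 <= point_dist G x y.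
Proof.
case: x => [r _|u v t [uv tl]] /=; first exact: dist_ge0.
apply: (dist_ge0 (subdiv_simple Gs uv tl) (subdiv_connected Gc t uv)).
Qed.

Lemma radius_le x T (c : R) : 0 <= c ->
  (radius G (fun=> 1) x T <= c) =
  [forall y in sg_vertices T, point_dist G x y <= c].
Proof.
move=> c0; rewrite /radius; apply/idP/forall_inP => [|H].
  by move=> /bigmax_leP[_ H] y /H; rewrite mul1r.
by apply/bigmax_leP; split=> // y /H; rewrite mul1r.
Qed.

(** Any k-subtree has its k vertices within its radius, and the subtree on the k closest vertices
    attains the least radius. In this form the k-th smallest distance never has to be named, and
    ties need no care. *)
Lemma phi_le k x (c : R) : on_graph G x -> (0 < k <= #|V|)%N ->
  (phi G (fun=> 1) k x <= c) = (k <= #|[set y | (point_dist G x y <= c)%R]%SET|)%N.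
Proof.
move=> xG kV; have [T [Tx cl]] := closest_subtree xG kV.
have card_T T' : subtrees_at G k x T' -> #|sg_vertices T'| = k by case=> [[]].
have rad_ge0 T' : 0 <= radius G (fun=> 1) x T' by apply: bigmax_ge_id.
have closest_min (b : R) : 0 <= b -> (k <= #|[set y | (point_dist G x y <= b)%R]%SET|)%N ->
    radius G (fun=> 1) x T <= b.
  move=> b0 kb; rewrite radius_le //; apply/forall_inP => y.
  by apply: closest_le => //; rewrite (card_T T).
have rad_card T' (b : R) : subtrees_at G k x T' -> radius G (fun=> 1) x T' <= b ->
    (k <= #|[set y | (point_dist G x y <= b)%R]%SET|)%N.
  move=> Tx' rb; rewrite -(card_T _ Tx'); apply: subset_leq_card.
  apply/fintype.subsetP => y yT; rewrite inE.
  by move: (rb); rewrite radius_le ?(le_trans (rad_ge0 T') rb) // => /forall_inP; apply.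
have -> : phi G (fun=> 1) k x = radius G (fun=> 1) x T.
  apply/le_anti/andP; split.
    by apply: ge_inf; [exists 0 => _ [T' _ <-]|exists T].
  apply: lb_le_inf; first by exists (radius G (fun=> 1) x T); exists T.
  by move=> _ [T' Tx' <-]; apply: closest_min (rad_card _ _ Tx' (lexx _)).
apply/idP/idP => [|kc]; first exact: rad_card.
(* As k > 0, some vertex lies within c, so c is nonnegative; the default 0 of the maximum requires
   this. *)
apply: closest_min => //; case/andP: kV => k0 _.
have /card_gt0P[y] := leq_trans k0 kc; rewrite inE.
exact/le_trans/point_dist_ge0.
Qed.
End Radius.

(** * Running programs *)

Section Framework.
Variable R : realType.
Implicit Types (s : state R) (c : cmd).

(* Only meaningful for loop-free commands. *)
Fixpoint denote c s : state R :=
  match c with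
  | Skip | While _ _ => s
  | ISet a i e => State (update (imem s) a (ieval s i) (ieval s e)) (rmem s)
  | RSet a i e => State (imem s) (update (rmem s) a (ieval s i) (reval s e))
  | Seq c1 c2 => denote c2 (denote c1 s)
  | If b c1 c2 => if beval s b then denote c1 s else denote c2 s
  end.

Fixpoint loop_free c : bool :=
  match c with
  | While _ _ => false
  | Seq c1 c2 | If _ c1 c2 => loop_free c1 && loop_free c2
  | _ => true
  end.

(** The dearer branch of a test is charged, so the bound does not depend on the state. The value at
    a loop is a dummy. *)
Fixpoint cost c : nat :=
  match c with
  | Skip => 1
  | ISet _ i e => (icost i + icost e).+1
  | RSet _ i e => (icost i + rcost e).+1
  | Seq c1 c2 => cost c1 + cost c2
  | If b c1 c2 => (bcost b + maxn (cost c1) (cost c2)).+1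
  | While _ _ => 0
  end.

Fixpoint imods c : seq nat :=
  match c with
  | ISet a _ _ => [:: a]
  | Seq c1 c2 | If _ c1 c2 => imods c1 ++ imods c2
  | While _ c1 => imods c1
  | _ => [::]
  end.

Fixpoint rmods c : seq nat :=
  match c with
  | RSet a _ _ => [:: a]
  | Seq c1 c2 | If _ c1 c2 => rmods c1 ++ rmods c2
  | While _ c1 => rmods c1
  | _ => [::]
  end.

Definition agree (ims rms : seq nat) s s' : Prop :=
  (forall a, a \notin ims -> imem s' a =1 imem s a) /\
  (forall a, a \notin rms -> rmem s' a =1 rmem s a).

Lemma agree_refl ims rms s : agree ims rms s s.
Proof. by []. Qed.

Lemma agree_trans ims rms s2 s1 s3 :
  agree ims rms s1 s2 -> agree ims rms s2 s3 -> agree ims rms s1 s3.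
Proof.
move=> [i12 r12] [i23 r23].
by split=> a am i; [rewrite i23 ?i12 | rewrite r23 ?r12].
Qed.

Lemma agreeW ims rms ims' rms' s s' : {subset ims <= ims'} -> {subset rms <= rms'} ->
  agree ims rms s s' -> agree ims' rms' s s'.
Proof.
move=> si sr [ai ar].
by split=> a am; [apply: ai; apply: contra am => /si | apply: ar; apply: contra am => /sr].
Qed.

Lemma exec_agree c s s' t : exec c s s' t -> agree (imods c) (rmods c) s s'.
Proof.
elim=> {c s s' t} //=.
- by move=> s a i e; split=> //= a'; rewrite inE /update => /negPf-> j.
- by move=> s a i e; split=> //= a'; rewrite inE /update => /negPf-> j.
- move=> c1 c2 s s1 s2 t1 t2 _ a1 _ a2.
  by apply: agree_trans (agreeW _ _ a1) (agreeW _ _ a2) => x xm; rewrite mem_cat xm ?orbT.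
- move=> b c1 c2 s s1 t _ _; apply: agreeW => x xm; by rewrite mem_cat xm.
- move=> b c1 c2 s s1 t _ _; apply: agreeW => x xm; by rewrite mem_cat xm orbT.
- by move=> b c s s1 s2 t1 t2 _ _ a1 _; apply: agree_trans.
Qed.

(** A total-correctness triple with a time budget T. *)
Definition runs c s T (Q : state R -> Prop) : Prop :=
  exists s' t, [/\ exec c s s' t, t <= T & Q s'].

(** Besides the consequence rule this is the frame rule: the new postcondition may use that arrays
    never assigned by the command are unchanged. *)
Lemma runs_weaken c s T T' (Q Q' : state R -> Prop) :
  runs c s T Q -> T <= T' ->
  (forall s', agree (imods c) (rmods c) s s' -> Q s' -> Q' s') -> runs c s T' Q'.
Proof.
move=> [s' [t [cs tT Qs]]] TT' QQ'; exists s', t; split=> //.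
  exact: leq_trans TT'.
exact: QQ' (exec_agree cs) Qs.
Qed.

Lemma runs_loop_free c s (Q : state R -> Prop) :
  loop_free c -> Q (denote c s) -> runs c s (cost c) Q.
Proof.
move=> lf Qs; suff [t ct le] : exists2 t, exec c s (denote c s) t & t <= cost c.
  by exists (denote c s), t.
elim: c s lf {Qs} => [|a i e|a i e|c1 IH1 c2 IH2|b c1 IH1 c2 IH2|] //= s.
- by exists 1 => //; constructor.
- by eexists; first by constructor.
- by eexists; first by constructor.
- case/andP=> /(IH1 s)[t1 e1 le1] /(IH2 (denote c1 s))[t2 e2 le2].
  by exists (t1 + t2); [apply: ExecSeq e1 e2 | apply: leq_add].
- case/andP=> /(IH1 s)[t1 e1 le1] /(IH2 s)[t2 e2 le2]; case: ifPn => bs.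
    exists (bcost b + t1).+1; first exact: ExecIfTrue.
    by rewrite ltnS leq_add2l (leq_trans le1) ?leq_maxl.
  exists (bcost b + t2).+1; first exact: ExecIfFalse.
  by rewrite ltnS leq_add2l (leq_trans le2) ?leq_maxr.
Qed.

Lemma denote_agree c s : loop_free c -> agree (imods c) (rmods c) s (denote c s).
Proof.
move=> lf; have [s' [t [cs _ E]]] := runs_loop_free lf (erefl (denote c s)).
by rewrite E; apply: exec_agree cs.
Qed.

Lemma runs_seq c1 c2 s T1 T2 (Q : state R -> Prop) :
  runs c1 s T1 (fun s1 => runs c2 s1 T2 Q) -> runs (Seq c1 c2) s (T1 + T2) Q.
Proof.
move=> [s1 [t1 [e1 le1 [s2 [t2 [e2 le2 Qs]]]]]].
by exists s2, (t1 + t2); split; [apply: ExecSeq e1 e2 | apply: leq_add |].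
Qed.

Lemma runs_seq_loop_free c1 c2 s T (Q : state R -> Prop) :
  loop_free c1 -> runs c2 (denote c1 s) T Q -> runs (Seq c1 c2) s (cost c1 + T) Q.
Proof. by move=> lf r; apply/runs_seq/runs_loop_free. Qed.

(** The measure drops in every iteration, so there are at most [mu s] iterations and one final
    failing test. The frame relative to the initial state is available in the body, so the invariant
    need not mention untouched arrays. *)
Lemma runs_while (mu : state R -> nat) (I : state R -> Prop) b c s T :
  I s ->
  (forall s', agree (imods c) (rmods c) s s' -> I s' -> beval s' b ->
     runs c s' T (fun s'' => I s'' /\ mu s'' < mu s')) ->
  runs (While b c) s ((T + bcost b).+1 * (mu s).+1)
    (fun s' => [/\ agree (imods c) (rmods c) s s', I s' & ~~ beval s' b]).
Proof.
move=> Is step.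
suff H N s1 : agree (imods c) (rmods c) s s1 -> I s1 -> mu s1 <= N ->
    runs (While b c) s1 ((T + bcost b).+1 * N + (bcost b).+1)
      (fun s' => [/\ agree (imods c) (rmods c) s s', I s' & ~~ beval s' b]).
  apply: runs_weaken (H (mu s) s (agree_refl _ _ _) Is (leqnn _)) _ _ => //.
  by rewrite mulnS addnC leq_add2r ltnS leq_addl.
elim: N s1 => [|N IH] s1 a1 I1 le; case: (boolP (beval s1 b)) => b1.
- have [s2 [t [_ _ [_]]]] := step s1 a1 I1 b1.
  by move/leq_trans/(_ le).
- exists s1, (bcost b).+1; split=> //; last exact: leq_addl.
  exact: ExecWhileFalse.
- have [s2 [t [e2 tT [I2 lt]]]] := step s1 a1 I1 b1.
  have a2 := agree_trans a1 (exec_agree e2).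
  have [|s3 [t3 [e3 t3T Q3]]] := IH s2 a2 I2; first by rewrite -ltnS (leq_trans lt).
  exists s3, (bcost b + t + t3).+1; split=> //; first exact: ExecWhileTrue e2 e3.
  lia.
- exists s1, (bcost b).+1; split=> //; last exact: leq_addl.
  exact: ExecWhileFalse.
Qed.

End Framework.

(** * Sorting *)

Section MergeLists.
Variables (T : eqType) (leT : rel T).
Hypothesis leT_total : total leT.

(** One bottom-up pass of merge sort. It is a relation because the recursion is not structural and,
    for w = 0, would not terminate. *)
Inductive merged (w : nat) : seq T -> seq T -> Prop :=
  | Merged_nil : merged w [::] [::]
  | Merged_cons s s' : merged w (drop w (drop w s)) s' ->
      merged w s (merge leT (take w s) (take w (drop w s)) ++ s').

Definition block_sorted (w : nat) (s : seq T) : Prop :=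
  forall q, sorted leT (take w (drop (q * w) s)).

Lemma merged_perm w s s' : merged w s s' -> perm_eq s' s.
Proof.
elim=> // {}s {}s' _ IH; rewrite -[X in perm_eq _ X](cat_take_drop w s).
rewrite -[X in take w s ++ X](cat_take_drop w) catA perm_cat //.
by rewrite perm_merge.
Qed.

Lemma merged_sorted w s s' : merged w s s' -> block_sorted w s ->
  block_sorted (w + w) s'.
Proof.
elim=> [|{}s {}s' m IH] bs q //; set x := merge _ _ _.
have size_x : size x = minn (w + w) (size s).
  by rewrite size_merge size_cat !size_take_min size_drop; lia.
have x_sorted : sorted leT x.
  rewrite merge_sorted //; last by have := bs 1; rewrite mul1n.
  by have := bs 0; rewrite drop0.
have [le|lt] := leqP (w + w) (size s).
  case: q => [|q].
    by rewrite mul0n drop0 take_cat size_x (minn_idPl le) ltnn subnn take0 cats0.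
  rewrite mulSn addnC -drop_drop drop_cat size_x (minn_idPl le) ltnn subnn drop0.
  apply: IH => q'; rewrite !drop_drop.
  have -> : q' * w + w + w = q'.+2 * w by lia.
  exact: bs.
(* An incomplete first pair of blocks is also the last one. *)
have -> : s' = [::].
  apply/eqP; rewrite -size_eq0 (perm_size (merged_perm m)) !size_drop; apply/eqP; lia.
rewrite cats0; case: q => [|q].
  by rewrite mul0n drop0 take_oversize // size_x geq_minl.
by rewrite drop_oversize // size_x mulSn; lia.
Qed.

End MergeLists.

(** * Merge sort as a program *)

Definition ivar a := IGet a (IConst 0).
Definition rvar a := RGet a (IConst 0).
Definition set_ivar a e := ISet a (IConst 0) e.
Definition set_rvar a e := RSet a (IConst 0) e.
Definition incr a := set_ivar a (IAdd (ivar a) (IConst 1)).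
Definition ilt e1 e2 := BNot (BILe e2 e1).
Definition imin e1 e2 := ISub e1 (ISub e1 e2).

Local Notation "c1 ;; c2" := (Seq c1 c2) (at level 80, right associativity).
(* A scalar variable is cell 0 of an array of its own. *)
Local Notation n_ := (ivar 0).
Local Notation order_ := 5.
Local Notation tmp_ := 6.
Local Notation p_ := 11.
Local Notation i_ := 12.
Local Notation j_ := 13.
Local Notation mid_ := 14.
Local Notation hi_ := 15.
Local Notation width_ := 16.
Local Notation row_ := 17.

Definition key (e : iexp) := RGet 0 (IAdd (ivar row_) e).

(** A single loop emits one element per iteration, which makes the pass visibly linear; the next
    pair of blocks is opened once the current pair is used up. The zeros set by [merge_pass]
    describe a used-up pair, so the first iteration opens one. *)
Definition open_block :=
  If (BILe (ivar hi_) (ivar p_))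
    (set_ivar i_ (ivar p_) ;;
     set_ivar mid_ (imin (IAdd (ivar p_) (ivar width_)) n_) ;;
     set_ivar j_ (ivar mid_) ;;
     set_ivar hi_ (imin (IAdd (ivar mid_) (ivar width_)) n_))
    Skip.

(** Ties go to the left block, as in [merge]. *)
Definition take_left :=
  BAnd (ilt (ivar i_) (ivar mid_))
    (BNot (BAnd (ilt (ivar j_) (ivar hi_))
      (BNot (BRLe (key (IGet order_ (ivar i_))) (key (IGet order_ (ivar j_))))))).

Definition emit_least :=
  If take_left
    (ISet tmp_ (ivar p_) (IGet order_ (ivar i_)) ;; incr i_)
    (ISet tmp_ (ivar p_) (IGet order_ (ivar j_)) ;; incr j_) ;;
  incr p_.

Definition merge_pass :=
  set_ivar p_ (IConst 0) ;; set_ivar i_ (IConst 0) ;; set_ivar j_ (IConst 0) ;;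
  set_ivar mid_ (IConst 0) ;; set_ivar hi_ (IConst 0) ;;
  While (ilt (ivar p_) n_) (open_block ;; emit_least).

Definition copy_back :=
  set_ivar p_ (IConst 0) ;;
  While (ilt (ivar p_) n_)
    (ISet order_ (ivar p_) (IGet tmp_ (ivar p_)) ;; incr p_).

Definition sort_row :=
  set_ivar p_ (IConst 0) ;;
  While (ilt (ivar p_) n_) (ISet order_ (ivar p_) (ivar p_) ;; incr p_) ;;
  set_ivar width_ (IConst 1) ;;
  While (ilt (ivar width_) n_)
    (merge_pass ;; copy_back ;; set_ivar width_ (IAdd (ivar width_) (ivar width_))).

(** * Correctness and running time of the merge sort *)

Section Sorting.
Variable R : realType.
Implicit Types s : state R.

Definition key_le s : rel nat :=
  fun x y => (rmem s 0 (imem s row_ 0 + x) <= rmem s 0 (imem s row_ 0 + y))%R.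

Lemma key_le_total s : total (key_le s).
Proof. by move=> x y; apply: le_total. Qed.

Lemma agree_key_le ims s s' :
  agree ims [::] s s' -> row_ \notin ims -> key_le s' = key_le s.
Proof.
by move=> [ai ar] rn; apply/boolp.funext => x; apply/boolp.funext => y; rewrite /key_le !ar // !ai.
Qed.

Definition seg (f : nat -> nat) i j := map f (index_iota i j).

Lemma size_seg f i j : size (seg f i j) = j - i.
Proof. by rewrite size_map size_iota. Qed.

Lemma seg_nil f i : seg f i i = [::].
Proof. by rewrite /seg /index_iota subnn. Qed.

Lemma seg_cons f i j : i < j -> seg f i j = f i :: seg f i.+1 j.
Proof.
rewrite /seg /index_iota => ij; rewrite subnS.
by case: (j - i) (subn_gt0 i j) => //=; rewrite ij.
Qed.

Lemma seg_rcons f i j : i <= j -> seg f i j.+1 = rcons (seg f i j) (f j).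
Proof.
by move=> ij; rewrite /seg /index_iota subSn // -addn1 iotaD map_cat /= subnKC // cats1.
Qed.

Lemma eq_seg f g i j : (forall x, i <= x < j -> f x = g x) -> seg f i j = seg g i j.
Proof. by move=> fg; apply/eq_in_map => x; rewrite mem_index_iota => /fg. Qed.

Lemma take_seg w f i j : i <= j -> take w (seg f i j) = seg f i (minn (i + w) j).
Proof.
by move=> ij; rewrite /seg -map_take /index_iota take_iota; congr (map f (iota i _)); lia.
Qed.

Lemma drop_seg w f i j : i <= j -> drop w (seg f i j) = seg f (minn (i + w) j) j.
Proof.
move=> ij; rewrite /seg -map_drop /index_iota drop_iota.
have [le|lt] := leqP (i + w) j; first by congr (map f (iota _ _)); lia.
by rewrite subnn (_ : j - i - w = 0) //; lia.
Qed.

Lemma subn_min a b : a - (a - b) = minn a b.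
Proof. lia. Qed.

(* Block boundaries in the invariant: order[i, mid) and order[j, hi) are what is
   left of the two blocks being merged. *)
Lemma merge_pass_runs : exists C, forall s n w,
  imem s 0 0 = n -> imem s width_ 0 = w -> 0 < w ->
  runs merge_pass s (C * n.+1) (fun s' =>
    merged (key_le s) w (seg (imem s order_) 0 n) (seg (imem s' tmp_) 0 n)).
Proof.
exists (5 * cost (set_ivar p_ (IConst 0)) +
  (cost (open_block ;; emit_least) + bcost (ilt (ivar p_) n_)).+1) => s n w sn sw w0.
set f := imem s order_; set le := key_le s.
pose I s' := exists p i j mid hi,
  [/\ imem s' p_ 0 = p, imem s' i_ 0 = i, imem s' j_ 0 = j, imem s' mid_ 0 = mid &
   imem s' hi_ 0 = hi] /\
  [/\ p <= n, i <= mid, j <= hi <= n, hi = p + (mid - i) + (hi - j) &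
   (* [merged] recurses on the tail whereas the loop produces the head first, so the invariant is
      stated relative to any result [rest] for the part after [hi]. *)
   forall rest, merged le w (seg f hi n) rest ->
     merged le w (seg f 0 n)
       (seg (imem s' tmp_) 0 p ++ merge le (seg f i mid) (seg f j hi) ++ rest)].
apply: runs_weaken.
- do 5![apply: runs_seq_loop_free => //].
  apply: (runs_while (mu := fun s' => n - imem s' p_ 0) (I := I)).
    by exists 0, 0, 0, 0, 0; split=> //; split=> // rest; rewrite !seg_nil.
  move=> s1 a1 I1 b1.
  have n1 : imem s1 0 0 = n by rewrite -sn; apply: a1.1.
  have w1 : imem s1 width_ 0 = w by rewrite -sw; apply: a1.1.
  have f1 x : imem s1 order_ x = f x by apply: a1.1.
  have le1 : key_le s1 = le by apply: (agree_key_le a1).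
  have pn : imem s1 p_ 0 < n by move: b1; rewrite /= n1 ltnNge.
  apply: runs_seq.
  pose Q s2 := [/\ I s2, imem s2 p_ 0 = imem s1 p_ 0 & imem s2 p_ 0 < imem s2 hi_ 0].
  apply: (runs_weaken (runs_loop_free (c := open_block) (Q := Q) _ _) (leqnn _)) => //.
    rewrite /Q.
    case: I1 pn => p [i [j [mid [hi [[Ep Ei Ej Em Eh] [pn' im jh E H]]]]]] pn.
    rewrite /=; case: ifP; rewrite Ep Eh => hip; last first.
      by rewrite ltnNge hip; split=> //; exists p, i, j, mid, hi.
    rewrite /update /= !subn_min Ep n1 w1; split=> //; last first.
      rewrite -Ep in pn *; lia.
    have hp : hi = p by lia.
    have [im' jh'] : i = mid /\ j = hi by lia.
    exists p, p, (minn (p + w) n), (minn (p + w) n), (minn (minn (p + w) n + w) n); split=> //.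
    split=> //; try lia.
    move=> rest; set mid' := minn (p + w) n => mr.
    (* Opening a pair instantiates the old [rest] by the merge of this pair followed by the new
       [rest]. *)
    have := H (merge le (seg f p mid') (seg f mid' (minn (mid' + w) n)) ++ rest).
    rewrite im' jh' !seg_nil /= hp; apply.
    have pn2 : p <= n by []. have mn : mid' <= n by rewrite geq_minr.
    rewrite -(take_seg w f pn2) -(take_seg w f mn) -(drop_seg w f pn2).
    by apply: Merged_cons; rewrite !drop_seg.
  move=> s2 a2 [I2 Ep2 plt].
  have n2 : imem s2 0 0 = n by rewrite -n1; apply: a2.1.
  have f2 x : imem s2 order_ x = f x by rewrite -f1; apply: a2.1.
  have le2 : key_le s2 = le by rewrite -le1; apply: (agree_key_le a2).
  apply: (runs_loop_free (c := emit_least)) => //.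
  case: I2 plt Ep2 => p [i [j [mid [hi [[Ep Ei Ej Em Eh] [pn' im jh E H]]]]]].
  rewrite Ep Eh => phi Ep2; rewrite -Ep2 in pn *.
  have tl : beval s2 take_left = (i < mid) && ~~ ((j < hi) && ~~ le (f i) (f j)).
    by rewrite /= Ei Ej Em Eh -!ltnNge !f2 -le2.
  have upd y : seg (fun i' => if i' == p then y else imem s2 tmp_ i') 0 p.+1 =
      rcons (seg (imem s2 tmp_) 0 p) y.
    rewrite seg_rcons // eqxx; congr rcons; apply: eq_seg => z; case: eqP; lia.
  have merges0 (r : seq nat) : merge le r [::] = r by case: r.
  rewrite /emit_least; move: take_left tl => b tl; rewrite /= {}tl.
  case: ifP => [/andP[imid jle]|tl].
    rewrite /update /= Ep Ei f2; split; last lia.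
    exists (p + 1), (i + 1), j, mid, hi; split=> //; split; try lia.
    move=> rest /H; rewrite addn1 upd -cats1 -catA /= (seg_cons f imid) addn1.
    have [jhi|jhi] := ltnP j hi.
      by move: jle; rewrite (seg_cons f jhi) jhi /= negbK => ->.
    have -> : j = hi by lia.
    by rewrite seg_nil !merges0.
  rewrite /update /= Ep Ej f2; split; last lia.
  have jhi : j < hi by lia.
  exists (p + 1), i, (j + 1), mid, hi; split=> //; split; try lia.
  move=> rest /H; rewrite addn1 upd -cats1 -catA /= (seg_cons f jhi) addn1.
  have [imid|imid] := ltnP i mid.
    by move: tl; rewrite (seg_cons f imid) imid jhi /= negbK => ->.
  have -> : i = mid by lia.
  by rewrite seg_nil.
- rewrite /= !subn0; nia.
- move=> s' _ [a' [p [i [j [mid [hi [[Ep Ei Ej Em Eh] [pn' im jh E H]]]]]]]].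
  have n1 : imem s' 0 0 = n by rewrite -sn; apply: a'.1.
  rewrite /= Ep n1 negbK => np; have := H [::].
  have -> : p = n by lia.
  have -> : hi = n by lia.
  have -> : j = n by lia.
  have -> : i = mid by lia.
  by rewrite !seg_nil /= cats0; apply; constructor.
Qed.

Lemma copy_back_runs : exists C, forall s n, imem s 0 0 = n ->
  runs copy_back s (C * n.+1) (fun s' =>
    seg (imem s' order_) 0 n = seg (imem s tmp_) 0 n).
Proof.
set body := (ISet order_ (ivar p_) (IGet tmp_ (ivar p_)) ;; incr p_).
exists (cost (set_ivar p_ (IConst 0)) + (cost body + bcost (ilt (ivar p_) n_)).+1) => s n sn.
pose I s' := imem s' p_ 0 <= n /\ forall i, i < imem s' p_ 0 -> imem s' order_ i = imem s tmp_ i.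
apply: runs_weaken.
- apply: runs_seq_loop_free => //.
  apply: (runs_while (mu := fun s' => n - imem s' p_ 0) (I := I)); first by split.
  move=> s1 a1 [pn I1] b1; apply: runs_loop_free => //.
  have n1 : imem s1 0 0 = n by rewrite -sn; apply: a1.1.
  have t1 x : imem s1 tmp_ x = imem s tmp_ x by apply: a1.1.
  have pn1 : imem s1 p_ 0 < n by move: b1; rewrite /= n1 ltnNge.
  rewrite /I /= /update /=; split; last lia.
  split=> [|i]; first lia.
  by case: eqP => [-> _|ne lt]; [apply: t1|apply: I1; lia].
- rewrite /= subn0; nia.
- move=> s' _ [a' [pn I'] b']; apply: eq_seg => i /andP[_ i_n]; apply: I'.
  have n1 : imem s' 0 0 = n by rewrite -sn; apply: a'.1.
  by move: b'; rewrite /= n1 negbK; exact: leq_trans.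
Qed.

Lemma sort_row_runs : exists C, forall s n, imem s 0 0 = n -> 0 < n ->
  runs sort_row s (C * (n.+1 * (trunc_log 2 n).+1)) (fun s' =>
    perm_eq (seg (imem s' order_) 0 n) (iota 0 n) /\
    sorted (key_le s) (seg (imem s' order_) 0 n)).
Proof.
have [C1 pass_runs] := merge_pass_runs; have [C2 copy_runs] := copy_back_runs.
set init := (ISet order_ (ivar p_) (ivar p_) ;; incr p_).
set dbl := set_ivar width_ (IAdd (ivar width_) (ivar width_)).
exists (2 * cost (set_ivar p_ (IConst 0)) + (cost init + bcost (ilt (ivar p_) n_)).+1 +
  2 * (C1 + C2 + cost dbl + bcost (ilt (ivar p_) n_)).+1) => s n sn n0.
pose I1 s' := imem s' p_ 0 <= n /\ forall i, i < imem s' p_ 0 -> imem s' order_ i = i.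
pose I2 s' := [/\ 0 < imem s' width_ 0, perm_eq (seg (imem s' order_) 0 n) (iota 0 n) &
  block_sorted (key_le s) (imem s' width_ 0) (seg (imem s' order_) 0 n)].
apply: (runs_weaken (Q := fun s' => perm_eq (seg (imem s' order_) 0 n) (iota 0 n) /\
    sorted (key_le s) (seg (imem s' order_) 0 n))).
- apply: runs_seq_loop_free => //; apply: runs_seq.
  apply: runs_weaken.
  + apply: (runs_while (mu := fun s' => n - imem s' p_ 0) (I := I1)); first by split.
    move=> s1 a1 [pn H1] b1; apply: runs_loop_free => //.
    have n1 : imem s1 0 0 = n by rewrite -sn; apply: a1.1.
    have pn1 : imem s1 p_ 0 < n by move: b1; rewrite /= n1 ltnNge.
    rewrite /I1 /= /update /=; split; last lia.
    split=> [|i]; first lia.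
    by case: eqP => [-> _|ne lt] //; apply: H1; lia.
  + exact: leqnn.
  move=> s1 _ [a1 [pn H1] b1].
  have n1 : imem s1 0 0 = n by rewrite -sn; apply: a1.1.
  have ord1 : seg (imem s1 order_) 0 n = iota 0 n.
    rewrite -[RHS]map_id /seg /index_iota subn0; apply/eq_in_map => x.
    rewrite mem_iota => /andP[_ xn]; apply: H1; move: b1; rewrite /= n1 negbK; exact: leq_trans.
  apply: runs_seq_loop_free => //.
  apply: (runs_weaken (T' := (C1 * n.+1 + (C2 * n.+1 + cost dbl) +
    bcost (ilt (ivar width_) n_)).+1 * (trunc_log 2 n).+2)).
  (* Doubling the width raises its logarithm by exactly one; the successor keeps the difference
     positive before the last pass. *)
  + apply: (runs_while (mu := fun s' => (trunc_log 2 n).+1 - trunc_log 2 (imem s' width_ 0)) (I := I2)).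
      split=> //; rewrite /= {1}/update /= ord1 // => q.
      by case: (drop _ _) => [|x []].
    move=> s2 a2 [w0 pe bs] b2.
    have n2 : imem s2 0 0 = n by rewrite -n1; apply: a2.1.
    have wn : imem s2 width_ 0 < n by move: b2; rewrite /= n2 ltnNge.
    have le2 : key_le s2 = key_le s.
      exact: etrans (agree_key_le a2 isT) (agree_key_le a1 isT).
    apply: runs_seq; apply: (runs_weaken (pass_runs s2 n _ n2 erefl w0) (leqnn _)) => s3 a3 m3.
    have n3 : imem s3 0 0 = n by rewrite -n2; apply: a3.1.
    apply: runs_seq; apply: (runs_weaken (copy_runs s3 n n3) (leqnn _)) => s4 a4 e4.
    apply: runs_loop_free => //.
    have w4 : imem s4 width_ 0 = imem s2 width_ 0.
      by rewrite a4.1 // a3.1.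
    rewrite le2 in m3; rewrite /I2 /= /update /= w4 e4; split; first split.
    * by rewrite addn_gt0 w0.
    * exact: perm_trans (merged_perm m3) pe.
    * exact: merged_sorted (@key_le_total s) _ _ _ m3 bs.
    have : trunc_log 2 (imem s2 width_ 0) <= trunc_log 2 n by apply: leq_trunc_log (ltnW wn).
    by rewrite addnn -mul2n trunc_logMp //; lia.
  + by apply: leq_mul; rewrite // ltnS leq_subr.
  move=> s' a' [_ [w0 pe bs] b']; split=> //.
  have n' : imem s' 0 0 = n by rewrite -n1; apply: a'.1.
  have := bs 0; rewrite mul0n drop0 take_oversize // size_seg subn0.
  by move: b'; rewrite /= n' negbK.
- have bound a b d e N L : 0 < N ->
      a + (b * N + (a + (C1 * N + (C2 * N + d) + e).+1 * L.+2)) <=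
      (2 * a + b + 2 * (C1 + C2 + d + e).+1) * (N * L.+1).
    move=> N0; have le1 : (C1 * N + (C2 * N + d) + e).+1 <= (C1 + C2 + d + e).+1 * N by nia.
    have le2 : L.+2 <= 2 * L.+1 by lia.
    have := leq_mul le1 le2; have : 0 < N * L.+1 by rewrite muln_gt0 N0.
    have : N <= N * L.+1 by rewrite leq_pmulr.
    nia.
  have := bound (cost (set_ivar p_ (IConst 0))) (cost init + bcost (ilt (ivar p_) n_)).+1
    (cost dbl) (bcost (ilt (ivar p_) n_)) n.+1 (trunc_log 2 n) isT.
  by rewrite /= subn0.
- by [].
Qed.
End Sorting.

(** * Candidate points on one edge *)

Section Candidates.
Local Open Scope ring_scope.
Variables (R : realType) (n : nat).
Implicit Types (key a b : nat -> R) (order rank A B : nat -> nat).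

(** [order] is a sorting permutation of the numbers below n and [rank] its inverse. Both are
    functions on all naturals because they are contents of memory arrays; cells from n on are
    unconstrained. *)
Record ranking key order rank : Prop := Ranking {
  rank_lt : forall y, (y < n)%N -> (rank y < n)%N;
  rankK : forall y, (y < n)%N -> order (rank y) = y;
  order_lt : forall p, (p < n)%N -> (order p < n)%N;
  orderK : forall p, (p < n)%N -> rank (order p) = p;
  order_key : forall p q, (p <= q)%N -> (q < n)%N -> key (order p) <= key (order q)
}.

Lemma ranking_sorted key order rank :
  perm_eq (map order (iota 0 n)) (iota 0 n) ->
  sorted (fun x y => key x <= key y) (map order (iota 0 n)) ->
  (forall p, (p < n)%N -> rank (order p) = p) -> ranking key order rank.
Proof.
move=> pe so rk.
have inv y : (y < n)%N -> exists2 p, (p < n)%N & y = order p.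
  move=> yn; have : y \in map order (iota 0 n) by rewrite (perm_mem pe) mem_iota.
  by case/mapP=> p; rewrite mem_iota /= add0n => pn ->; exists p.
split=> //.
- by move=> y /inv[p pn ->]; rewrite rk.
- by move=> y /inv[p pn ->]; rewrite rk.
- move=> p pn; have : order p \in iota 0 n.
    by rewrite -(perm_mem pe); apply/mapP; exists p; rewrite ?mem_iota.
  by rewrite mem_iota.
- move=> p q pq qn; have pn := leq_ltn_trans pq qn.
  have tr : transitive (fun x y => key x <= key y) by move=> y x z; apply: le_trans.
  have := sorted_leq_nth tr (fun x => lexx (key x)) 0%N so.
  move/(_ p q); rewrite !inE size_map size_iota => /(_ pn qn pq).
  by rewrite !(nth_map 0%N) ?size_iota // !nth_iota.
Qed.

Lemma sub_count_iota (P Q : pred nat) :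
  (forall y, (y < n)%N -> P y -> Q y) ->
  (count P (iota 0 n) <= count Q (iota 0 n))%N.
Proof.
move=> PQ; rewrite (@eq_in_count _ P (predI P Q)); first by apply: sub_count => y /andP[].
by move=> y; rewrite mem_iota /= => yn; case Py: (P y) => //=; rewrite PQ.
Qed.

(** A down-closed set of positions is an initial segment, and its length is its count. *)
Lemma count_down_closed (P : pred nat) m p :
  (forall p q, (p <= q)%N -> (q < m)%N -> P q -> P p) -> (p < m)%N ->
  (p < count P (iota 0 m))%N = P p.
Proof.
elim: m => // m IH down pm; rewrite -[in iota _ _]addn1 iotaD count_cat /= addn0.
have size_m : (count P (iota 0 m) <= m)%N by rewrite -[X in (_ <= X)%N](size_iota 0) count_size.
case Pm: (P m).
  have -> : count P (iota 0 m) = m.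
    rewrite -[RHS](size_iota 0); apply/eqP; rewrite -all_count; apply/allP => q.
    by rewrite mem_iota /= add0n => /ltnW qm; apply: down Pm.
  by rewrite addn1 pm (down p m).
rewrite addn0; have down' p' q : (p' <= q)%N -> (q < m)%N -> P q -> P p'.
  by move=> pq qm; apply: down => //; apply: ltnW.
have [lt|le] := ltnP p m; first exact: IH.
have -> : p = m by lia.
by rewrite Pm ltnNge size_m.
Qed.

Section Ranking.
Variables (key : nat -> R) (order rank : nat -> nat).
Hypothesis rk : ranking key order rank.

Lemma ranking_perm : perm_eq (map order (iota 0 n)) (iota 0 n).
Proof.
apply: uniq_perm; rewrite ?iota_uniq //.
  rewrite map_inj_in_uniq ?iota_uniq // => p q; rewrite !mem_iota /= => pn qn E.
  by rewrite -(orderK rk pn) -(orderK rk qn) E.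
move=> y; rewrite mem_iota /= add0n; apply/mapP/idP => [[p]|yn].
  by rewrite mem_iota /= add0n => pn ->; apply: (order_lt rk).
by exists (rank y); rewrite ?(rankK rk) // mem_iota /= (rank_lt rk).
Qed.

Lemma count_order (P : pred nat) : count P (iota 0 n) = count (P \o order) (iota 0 n).
Proof. by have /seq.permP/(_ P) <- := ranking_perm; rewrite count_map. Qed.

Lemma count_rank_lt i : (i <= n)%N -> count (fun y => (rank y < i)%N) (iota 0 n) = i.
Proof.
move=> le; rewrite count_order -[n in iota 0 n](subnKC le) iotaD count_cat.
rewrite (@eq_in_count _ _ predT) ?count_predT ?size_iota; last first.
  move=> p; rewrite mem_iota /= add0n => pi; rewrite (orderK rk) //; lia.
rewrite (@eq_in_count _ _ pred0) ?count_pred0 ?addn0 // => p; rewrite mem_iota /= add0n.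
by move=> pi; rewrite (orderK rk) //; lia.
Qed.

(** Turns a threshold on keys into a prefix of the sorted order; this is how the vertices reached
    through one endpoint become an index. *)
Lemma rank_lt_count c y : (y < n)%N ->
  (rank y < count (fun y => (key y <= c)%R) (iota 0 n))%N = (key y <= c).
Proof.
move=> yn; rewrite count_order count_down_closed /= ?(rankK rk) ?(rank_lt rk) //.
by move=> p q pq qn; apply/le_trans/(order_key rk).
Qed.

Lemma kth_le k c : (0 < k <= n)%N ->
  (key (order k.-1) <= c) = (k <= count (fun y => (key y <= c)%R) (iota 0 n))%N.
Proof.
case/andP=> k0 kn; rewrite -rank_lt_count ?(orderK rk) ?(order_lt rk) //; lia.
Qed.

Lemma rank_lt_key i y : (y < n)%N -> (0 < i <= n)%N ->
  (rank y < i)%N -> key y <= key (order i.-1).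
Proof.
move=> yn /andP[i0 i_n] yi; rewrite -{1}(rankK rk yn); apply: (order_key rk); lia.
Qed.
End Ranking.

Variables (a b : nat -> R) (A rA B rB : nat -> nat) (l : R).
Hypotheses (rkA : ranking a A rA) (rkB : ranking b B rB).

Definition union_count i j := count (fun y => (rA y < i) || (rB y < j))%N (iota 0 n).

Lemma leq_union_count i i' j j' : (i <= i')%N -> (j <= j')%N ->
  (union_count i j <= union_count i' j')%N.
Proof.
move=> ii jj; apply: sub_count => y /orP[lt|lt]; apply/orP; [left|right].
  exact: leq_trans lt ii.
exact: leq_trans lt jj.
Qed.

Lemma union_count_0l j : (j <= n)%N -> union_count 0 j = j.
Proof. exact: count_rank_lt rkB j. Qed.

Lemma union_count_0r i : (i <= n)%N -> union_count i 0 = i.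
Proof.
move=> le; rewrite -[RHS](count_rank_lt rkA le); apply: eq_count => y.
by rewrite ltn0 orbF.
Qed.

Lemma union_count_nl j : union_count n j = n.
Proof.
rewrite /union_count (@eq_in_count _ _ predT) ?count_predT ?size_iota // => y.
by rewrite mem_iota /= add0n => /(rank_lt rkA) ->.
Qed.

(** The equation between booleans read as naturals says that P and Q agree off x, and that x is
    gained exactly when c holds. *)
Lemma count_add_one (P Q : pred nat) x (c : bool) : (x < n)%N ->
  (forall y, (y < n)%N -> P y = (Q y + ((y == x) && c))%N :> nat) ->
  count P (iota 0 n) = (count Q (iota 0 n) + c)%N.
Proof.
move=> xn H; have -> : nat_of_bool c = (c * count_mem x (iota 0 n))%N.
  by rewrite count_uniq_mem ?iota_uniq // mem_iota /= xn muln1.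
have : all (fun y => y < n)%N (iota 0 n) by apply/allP => y; rewrite mem_iota.
elim: (iota 0 n) => [|y s IH] /=; first by rewrite muln0.
case/andP=> yn sn; by rewrite IH // H // -mulnb mulnDr (mulnC (y == x)) addnACA.
Qed.

(** The new vertex [B j] counts only if it is not already in the first prefix, which one look at its
    rank decides; this is the constant-time update of the walk. *)
Lemma union_count_Sr i j : (j < n)%N ->
  union_count i j.+1 = (union_count i j + (i <= rA (B j)))%N.
Proof.
move=> jn; apply: (@count_add_one _ _ (B j)); first exact: (order_lt rkB).
move=> y yn; have [->|ne] := eqVneq y (B j); first by rewrite (orderK rkB) //; lia.
have : rB y != j by apply: contra ne => /eqP <-; rewrite (rankK rkB).
by move/eqP; lia.
Qed.

Lemma union_count_Sl i j : (i < n)%N ->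
  union_count i.+1 j = (union_count i j + (j <= rB (A i)))%N.
Proof.
move=> jn; apply: (@count_add_one _ _ (A i)); first exact: (order_lt rkA).
move=> y yn; have [->|ne] := eqVneq y (A i); first by rewrite (orderK rkA) //; lia.
have : rA y != i by apply: contra ne => /eqP <-; rewrite (rankK rkA).
by move/eqP; lia.
Qed.

(* Along the edge, [t + a] increases and [l - t + b] decreases; they meet at this
   offset, at this value. *)
Definition meet_offset i j := (l + b (B j.-1) - a (A i.-1)) / 2.
Definition meet_value i j := (l + a (A i.-1) + b (B j.-1)) / 2.

(** At the meeting offset the last vertices of both prefixes are exactly at the meeting value, and
    earlier ones are no farther. *)
Lemma meet_value_count k i j : (0 < i <= n)%N -> (0 < j <= n)%N ->
  (k <= union_count i j)%N ->
  (k <= count (fun y => (Num.min (meet_offset i j + a y)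
                          (l - meet_offset i j + b y) <= meet_value i j)%R) (iota 0 n))%N.
Proof.
move=> i_n j_n /leq_trans; apply; apply: sub_count_iota => y yn.
rewrite ge_min /meet_offset /meet_value => /orP[lt|lt]; apply/orP; [left|right].
  by have := rank_lt_key rkA yn i_n lt; lra.
by have := rank_lt_key rkB yn j_n lt; lra.
Qed.

Hypothesis a_le : forall y, (y < n)%N -> a y <= l + b y.
Hypothesis b_le : forall y, (y < n)%N -> b y <= l + a y.

(** The pair (i, j) of a point need not be examined itself: by the covering hypothesis it suffices
    that it dominates an examined pair, whose keys are no larger. *)
Lemma best_le k best t c : (0 < k <= n)%N ->
  best <= a (A k.-1) -> best <= b (B k.-1) ->
  (forall i j, (i <= n)%N -> (0 < j <= n)%N -> (k <= union_count i j)%N ->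
     exists i' j', [/\ (i' <= i)%N, (0 < j' <= j)%N, (k <= union_count i' j')%N &
       (0 < i')%N -> 0 < meet_offset i' j' < l -> best <= meet_value i' j']) ->
  0 < t < l ->
  (k <= count (fun y => (Num.min (t + a y) (l - t + b y) <= c)%R) (iota 0 n))%N ->
  best <= c.
Proof.
move=> kn besta bestb cover /andP[t0 tl].
have viaA d : (k <= count (fun y => (a y <= d)%R) (iota 0 n))%N -> best <= d.
  by rewrite -(kth_le rkA _ kn); apply: le_trans.
have viaB d : (k <= count (fun y => (b y <= d)%R) (iota 0 n))%N -> best <= d.
  by rewrite -(kth_le rkB _ kn); apply: le_trans.
have count_n (P : pred nat) : (count P (iota 0 n) <= n)%N.
  by rewrite -[X in (_ <= X)%N](size_iota 0) count_size.
set i := count (fun y => (a y <= c - t)%R) (iota 0 n).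
set j := count (fun y => (b y <= c - (l - t))%R) (iota 0 n).
have -> : count (fun y => (Num.min (t + a y) (l - t + b y) <= c)%R) (iota 0 n) = union_count i j.
  apply: eq_in_count => y; rewrite mem_iota /= add0n => yn.
  rewrite ge_min (rank_lt_count rkA) // (rank_lt_count rkB) //.
  by congr (_ || _); apply/idP/idP; lra.
(* If no vertex is reached through v, then k vertices lie within c - t of u. *)
move=> kij; have [j0|j0] := posnP j.
  have := viaA (c - t); rewrite -/i; move: kij; rewrite j0 union_count_0r ?count_n // => ki.
  by move/(_ ki); lra.
have [|i' [j' [ii jj kij' best']]] := cover i j (count_n _) _ kij; first by rewrite j0 count_n.
have i_n : (i <= n)%N by apply: count_n. have j_n : (j <= n)%N by apply: count_n.
(* For i' = 0 there is no meeting point; the prefix of v alone holds k vertices, and v is at least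
   as good. *)
have [i'0|i'0] := posnP i'.
  rewrite i'0 union_count_0l in kij'; last lia.
  have kj : (k <= j)%N by lia.
  by have := viaB (c - (l - t)) kj; lra.
have ai : a (A i'.-1) <= c - t.
  rewrite -(rank_lt_count rkA) -/i ?(orderK rkA) ?(order_lt rkA) //; lia.
have bj : b (B j'.-1) <= c - (l - t).
  rewrite -(rank_lt_count rkB) -/j ?(orderK rkB) ?(order_lt rkB) //; lia.
have i'n : (0 < i' <= n)%N by lia. have j'n : (0 < j' <= n)%N by lia.
(* A nonpositive offset says that l plus the last key of v is at most the last key of u, so u
   reaches the second prefix through v within the latter. *)
have [t'0|t'0] := lerP (meet_offset i' j') 0.
  suff : best <= a (A i'.-1) by lra.
  apply: viaA; apply: leq_trans kij' _; apply: sub_count_iota => y.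
  move=> yn /orP[lt|lt]; first by have := rank_lt_key rkA yn i'n lt.
  move: t'0; rewrite /meet_offset; have := rank_lt_key rkB yn j'n lt; have := a_le yn; lra.
have [t'l|t'l] := lerP l (meet_offset i' j').
  suff : best <= b (B j'.-1) by lra.
  apply: viaB; apply: leq_trans kij' _; apply: sub_count_iota => y.
  move=> yn /orP[lt|lt]; last by have := rank_lt_key rkB yn j'n lt.
  move: t'l; rewrite /meet_offset; have := rank_lt_key rkA yn i'n lt; have := b_le yn; lra.
(* In the sum of [ai] and [bj] the offset t cancels, leaving the meeting value at most c. *)
have := best' i'0; rewrite t'0 t'l => /(_ isT); rewrite /meet_value; lra.
Qed.

End Candidates.

(** * The program *)

Local Notation k_ := (IGet 0 (IConst 2)).
Local Notation base_ := 4.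
Local Notation e_ := 10.
Local Notation uord_ := 7.
Local Notation urank_ := 8.
Local Notation vord_ := 21.
Local Notation vrank_ := 9.
Local Notation urow_ := 18.
Local Notation vrow_ := 19.
Local Notation c_ := 20.
Local Notation best_ := 2.
Local Notation t_ := 3.
Local Notation val_ := 4.
Local Notation u_ := (IGet 1 (ivar e_)).
Local Notation v_ := (IGet 2 (ivar e_)).

(** The machine cannot multiply naturals, so the starts of the matrix rows are tabulated by repeated
    addition. *)
Definition fill_base :=
  set_ivar p_ (IConst 0) ;;
  While (ilt (ivar p_) n_)
    (ISet base_ (IAdd (ivar p_) (IConst 1)) (IAdd (IGet base_ (ivar p_)) n_) ;;
     incr p_).

Definition record_order ord rank :=
  set_ivar p_ (IConst 0) ;;
  While (ilt (ivar p_) n_)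
    (ISet ord (ivar p_) (IGet order_ (ivar p_)) ;;
     ISet rank (IGet order_ (ivar p_)) (ivar p_) ;;
     incr p_).

Definition rank_row x row ord rank :=
  set_ivar row (IGet base_ x) ;; set_ivar row_ (ivar row) ;;
  sort_row ;; record_order ord rank.

Definition dist_u e := RGet 0 (IAdd (ivar urow_) (IGet uord_ e)).
Definition dist_v e := RGet 0 (IAdd (ivar vrow_) (IGet vord_ e)).
Definition pred_exp e := ISub e (IConst 1).

Definition output_vertex x :=
  set_rvar best_ (rvar val_) ;;
  set_ivar 3 (IConst 0) ;; ISet 3 (IConst 1) x.

(* At the first edge there is no previous value in [best_] to compare with. *)
Definition consider_u :=
  set_rvar val_ (dist_u (pred_exp k_)) ;;
  If (BNot (BAnd (ilt (IConst 0) (ivar e_)) (BNot (BRLe (rvar val_) (rvar best_)))))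
    (output_vertex u_) Skip.

Definition consider_v :=
  set_rvar val_ (dist_v (pred_exp k_)) ;;
  If (BRLe (rvar val_) (rvar best_)) (output_vertex v_) Skip.

Definition len_ := RGet 1 (ivar e_).

(** Offsets outside the open edge are no points of it and are rejected; an endpoint, already
    considered, is as good in that case. *)
Definition output_meet :=
  If (BAnd (BNot (BRLe (rvar t_) (RConst 0)))
       (BAnd (BNot (BRLe len_ (rvar t_))) (BRLe (rvar val_) (rvar best_))))
    (set_rvar best_ (rvar val_) ;;
     RSet best_ (IConst 1) (rvar t_) ;;
     set_ivar 3 (IConst 1) ;; ISet 3 (IConst 1) u_ ;; ISet 3 (IConst 2) v_)
    Skip.

Definition set_meet_offset :=
  set_rvar t_ (RDiv (RSub (RAdd len_ (dist_v (pred_exp (ivar j_))))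
                       (dist_u (pred_exp (ivar i_)))) (RConst 2)).

Definition set_meet_value :=
  set_rvar val_ (RDiv (RAdd (RAdd len_ (dist_u (pred_exp (ivar i_))))
                         (dist_v (pred_exp (ivar j_)))) (RConst 2)).

Definition consider_meet := set_meet_offset ;; set_meet_value ;; output_meet.

(** After the decrement, position j holds the vertex that leaves the second prefix; it leaves the
    union unless the first prefix contains it. *)
Definition shrink_j :=
  set_ivar j_ (pred_exp (ivar j_)) ;;
  If (BILe (ivar i_) (IGet urank_ (IGet vord_ (ivar j_))))
    (set_ivar c_ (pred_exp (ivar c_))) Skip.

Definition grow_i :=
  If (BILe (ivar j_) (IGet vrank_ (IGet uord_ (ivar i_)))) (incr c_) Skip ;;
  incr i_.

Definition scan_step :=
  If (BILe k_ (ivar c_))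
    (If (ilt (IConst 0) (ivar i_)) consider_meet Skip ;; shrink_j)
    grow_i.

(* (i, j) walks down the staircase boundary of the set of all (i, j) such that the
   first i vertices in the order of u and the first j in the order of v together
   are at least k; [c_] is the size of that union. *)
Definition scan :=
  set_ivar i_ (IConst 0) ;; set_ivar j_ n_ ;; set_ivar c_ n_ ;;
  While (ilt (IConst 0) (ivar j_)) scan_step.

Definition process_edge :=
  rank_row u_ urow_ uord_ urank_ ;; rank_row v_ vrow_ vord_ vrank_ ;;
  consider_u ;; consider_v ;; scan ;; incr e_.

Definition center_program :=
  fill_base ;;
  While (ilt (ivar e_) (IGet 0 (IConst 1))) process_edge.

(** * Row offsets and sorted rows in memory *)

Section Ranks.
Variable R : realType.
Implicit Types s : state R.

Lemma fill_base_runs : exists C, forall s n, imem s 0 0 = n -> imem s base_ 0 = 0 ->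
  runs fill_base s (C * n.+1) (fun s' => forall i, i <= n -> imem s' base_ i = i * n).
Proof.
pose body := (ISet base_ (IAdd (ivar p_) (IConst 1)) (IAdd (IGet base_ (ivar p_)) n_) ;; incr p_).
exists (cost (set_ivar p_ (IConst 0)) + (cost body + bcost (ilt (ivar p_) n_)).+1) => s n sn s0.
pose I s' := imem s' p_ 0 <= n /\ forall i, i <= imem s' p_ 0 -> imem s' base_ i = i * n.
apply: runs_weaken.
- apply: runs_seq_loop_free => //.
  apply: (runs_while (mu := fun s' => n - imem s' p_ 0) (I := I)).
    by split=> // i; rewrite leqn0 => /eqP ->; rewrite mul0n.
  move=> s1 a1 [pn I1] b1; apply: runs_loop_free => //.
  have n1 : imem s1 0 0 = n by rewrite -sn; apply: a1.1.
  have pn1 : imem s1 p_ 0 < n by move: b1; rewrite /= n1 ltnNge.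
  rewrite /I /= /update /=; split; last lia.
  split=> [|i]; first lia.
  case: eqP => [-> _|ne lt]; last by apply: I1; lia.
  by rewrite n1 I1 // mulnDl mul1n.
- rewrite /= subn0; nia.
- move=> s' _ [a' [pn I'] b'] i i_n; apply: I'.
  have n1 : imem s' 0 0 = n by rewrite -sn; apply: a'.1.
  by move: b'; rewrite /= n1 negbK; apply: leq_trans.
Qed.

(** Array names are literals, so non-interference is checked by cases on the two uses of the
    subroutine. *)
Definition rank_arrays := [:: (uord_, urank_); (vord_, vrank_)].

(** Injectivity of the order prevents a later write to the ranks from overwriting an earlier one. *)
Lemma record_order_runs : exists C, forall s n ord rank, (ord, rank) \in rank_arrays ->
  imem s 0 0 = n ->
  (forall p q, p < n -> q < n -> imem s order_ p = imem s order_ q -> p = q) ->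
  runs (record_order ord rank) s (C * n.+1) (fun s' =>
    forall p, p < n -> imem s' ord p = imem s order_ p /\ imem s' rank (imem s order_ p) = p).
Proof.
pose body := (ISet uord_ (ivar p_) (IGet order_ (ivar p_)) ;;
     ISet urank_ (IGet order_ (ivar p_)) (ivar p_) ;; incr p_).
exists (cost (set_ivar p_ (IConst 0)) + (cost body + bcost (ilt (ivar p_) n_)).+1).
move=> s n ord rank or sn inj.
pose I s' := imem s' p_ 0 <= n /\ forall i, i < imem s' p_ 0 ->
  imem s' ord i = imem s order_ i /\ imem s' rank (imem s order_ i) = i.
apply: runs_weaken.
- apply: runs_seq_loop_free => //.
  apply: (runs_while (mu := fun s' => n - imem s' p_ 0) (I := I)); first by split.
  move=> s1 a1 [pn I1] b1; apply: runs_loop_free => //.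
  have n1 : imem s1 0 0 = n.
    by move: or; rewrite !inE => /orP[]/eqP[E1 E2]; subst; rewrite a1.1.
  have o1 x : imem s1 order_ x = imem s order_ x.
    by move: or; rewrite !inE => /orP[]/eqP[E1 E2]; subst; rewrite a1.1.
  have pn1 : imem s1 p_ 0 < n by move: b1; rewrite /= n1 ltnNge.
  clear body; move: or I1; rewrite !inE /I => /orP[]/eqP[-> ->] I1;
    rewrite /= /update /= !o1; (split; last lia); (split=> [|i]; first lia);
    rewrite addn1 ltnS leq_eqVlt => /orP[/eqP->|lt]; rewrite ?eqxx //;
    rewrite (ltn_eqF lt); have [? ?] := I1 i lt; split=> //;
    case: eqP => // /inj -> //; lia.
- rewrite /= subn0; nia.
- move=> s' _ [a' [pn I'] b'] i i_n; apply: I'.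
  have n1 : imem s' 0 0 = n.
    by move: or; rewrite !inE => /orP[]/eqP[E1 E2]; subst; rewrite a'.1.
  by move: b'; rewrite /= n1 negbK; apply: leq_trans.
Qed.

Definition row_arrays := [:: (urow_, uord_, urank_); (vrow_, vord_, vrank_)].

(** The cost 3 is that of reading an endpoint of the current edge. *)
Lemma rank_row_runs : exists C, forall s n x row ord rank,
  (row, ord, rank) \in row_arrays ->
  imem s 0 0 = n -> 0 < n -> icost x <= 3 ->
  runs (rank_row x row ord rank) s (C * (n.+1 * (trunc_log 2 n).+1)) (fun s' =>
    imem s' row 0 = imem s base_ (ieval s x) /\
    ranking n (fun y => rmem s 0 (imem s' row 0 + y)) (imem s' ord) (imem s' rank)).
Proof.
have [C1 sort_runs] := sort_row_runs R; have [C2 record_runs] := record_order_runs.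
exists (20 + C1 + C2) => s n x row ord rank or sn n0 x3.
apply: (runs_weaken (T := cost (set_ivar urow_ (IGet base_ x)) + (cost (set_ivar row_ (ivar urow_)) +
  (C1 * (n.+1 * (trunc_log 2 n).+1) + C2 * n.+1)))
  (Q := fun s' => imem s' row 0 = imem s base_ (ieval s x) /\
    ranking n (fun y => rmem s 0 (imem s' row 0 + y)) (imem s' ord) (imem s' rank))) => //.
  apply: (runs_seq_loop_free (c1 := set_ivar row _)) => //.
  apply: (runs_seq_loop_free (c1 := set_ivar row_ _)) => //.
  set s1 := denote _ _.
  have n1 : imem s1 0 0 = n.
    by move: or; rewrite !inE => /orP[]/eqP[E1 E2 E3]; subst row ord rank.
  have row1 : imem s1 row 0 = imem s base_ (ieval s x) /\ imem s1 row_ 0 = imem s1 row 0.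
    by move: or; rewrite !inE => /orP[]/eqP[E1 E2 E3]; subst row ord rank.
  have r1 : rmem s1 = rmem s by [].
  move: s1 n1 row1 r1 => s1 n1 [row1 row1'] r1.
  apply: runs_seq; apply: (runs_weaken (sort_runs s1 n n1 n0) (leqnn _)) => s2 a2 [pe so].
  have n2 : imem s2 0 0 = n by rewrite -n1; apply: a2.1.
  have or' : (ord, rank) \in rank_arrays.
    by move: or; rewrite !inE => /orP[]/eqP[_ -> ->]; rewrite eqxx ?orbT.
  apply: (runs_weaken (record_runs s2 n ord rank or' n2 _) (leqnn _)) => [p q pn qn E|s3 a3 H].
    have : uniq (seg (imem s2 order_) 0 n) by rewrite (perm_uniq pe) iota_uniq.
    rewrite /seg /index_iota subn0 => /uniqP-/(_ 0 p q).
    by rewrite !inE size_map size_iota !(nth_map 0) ?size_iota // !nth_iota // => ->.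
  have row3 : imem s3 row 0 = imem s1 row 0.
    by move: or; rewrite !inE => /orP[]/eqP[E1 E2 E3]; subst; rewrite a3.1 // a2.1.
  split; first by rewrite row3.
  have ordE : [seq imem s3 ord i | i <- iota 0 n] = [seq imem s2 order_ i | i <- iota 0 n].
    by apply/eq_in_map => i; rewrite mem_iota /= add0n => /H[].
  move: pe so; rewrite /seg /index_iota subn0 -ordE => pe so.
  apply: ranking_sorted => //.
    by move: so; rewrite /key_le row1' r1 row3.
  by move=> p pn; have [-> ->] := H p pn.
rewrite /=; have : n.+1 <= n.+1 * (trunc_log 2 n).+1 by rewrite leq_pmulr.
move: (n.+1 * _) => N; nia.
Qed.
End Ranks.

Lemma nth_allpairs_mul (S T Z : Type) (f : S -> T -> Z) (r : seq S) (r' : seq T) a b c i j :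
  i < size r -> j < size r' ->
  nth c [seq f x y | x <- r, y <- r'] (i * size r' + j) = f (nth a r i) (nth b r' j).
Proof.
elim: r i => [|x r IH] [|i] //= ir jr; rewrite nth_cat size_map.
  by rewrite mul0n jr (nth_map b).
rewrite mulSn -addnA ltnNge leq_addr /= addKn; exact: IH.
Qed.

(** * Correctness and running time *)

Section Edges.
Local Open Scope ring_scope.
Variables (R : realType) (n k : nat) (G : wgraph R 'I_n) (es : seq ('I_n * 'I_n)).
Hypotheses (Gs : simple_graph G) (Gc : connected_graph G) (Ges : edge_list G es).
Hypothesis kn : (0 < k <= n)%N.
Implicit Types (s : state R) (u v x : 'I_n).
(** The constant of [rank_row_runs], abstracted so that it is chosen before the graph. *)
Variable C : nat.
Hypothesis rank_runs : forall s n (x : iexp) row ord rank, (row, ord, rank) \in row_arrays ->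
  imem s 0 0 = n -> (0 < n)%N -> (icost x <= 3)%N ->
  runs (rank_row x row ord rank) s (C * (n.+1 * (trunc_log 2 n).+1)) (fun s' =>
    imem s' row 0 = imem s base_ (ieval s x) /\
    ranking n (fun y => rmem s 0 (imem s' row 0 + y)) (imem s' ord) (imem s' rank)).

Let s0 := input G k es.
Let ph := phi G (fun _ : 'I_n => 1) k.
Let elength u v := elen G [set u; v]%SET.
Definition dist_row x (y : nat) : R := rmem s0 0 (x * n + y)%N.

Lemma dist_rowE x (y : 'I_n) : dist_row x y = dist G x y.
Proof.
rewrite /dist_row /= -[in X in (x * X)%N](size_enum_ord n).
by rewrite (nth_allpairs_mul _ x x) ?size_enum_ord // !nth_ord_enum.
Qed.

Lemma card_count (P : pred nat) : #|[set y : 'I_n | P y]%SET| = count P (iota 0 n).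
Proof. by rewrite cardsE cardE /enum_mem size_filter -val_enum_ord count_map enumT. Qed.

Lemma phi_vertex_le x c :
  (ph (VertexPoint x) <= c) = (k <= count (fun y => (dist_row x y <= c)%R) (iota 0 n))%N.
Proof.
rewrite /ph phi_le ?card_ord // -(card_count (fun y => dist_row x y <= c)).
by congr (k <= #|pred_of_set _|)%N; apply/setP => y; rewrite !inE dist_rowE.
Qed.

Lemma phi_edge_le u v t c : joins (edges G) u v -> 0 < t < elength u v ->
  (ph (EdgePoint u v t) <= c) =
  (k <= count (fun y => (Num.min (t + dist_row u y)
                          (elength u v - t + dist_row v y) <= c)%R) (iota 0 n))%N.
Proof.
move=> uv tl; rewrite /ph phi_le ?card_ord //.
rewrite -(card_count (fun y => Num.min (t + dist_row u y)
                                 (elength u v - t + dist_row v y) <= c)).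
congr (k <= #|pred_of_set _|)%N; apply/setP => y.
by rewrite !inE !dist_rowE /= dist_subdiv.
Qed.

(** The edge list fixes one orientation of each edge, while a point may be described from either
    end. *)
Lemma phi_edge_sym u v t : joins (edges G) u v -> 0 < t < elength u v ->
  ph (EdgePoint v u (elength u v - t)) = ph (EdgePoint u v t).
Proof.
move=> uv /andP[t0 tl]; have vu : joins (edges G) v u by rewrite joins_sym.
have lE : elength v u = elength u v by rewrite /elength finset.setUC.
have H c : (ph (EdgePoint v u (elength u v - t)) <= c) = (ph (EdgePoint u v t) <= c).
  rewrite !phi_edge_le ?lE //; try by apply/andP; split; lra.
  by congr (_ <= _)%N; apply: eq_count => y; rewrite minC subKr.
by apply/le_anti; rewrite H lexx -H lexx.
Qed.

(** Only an inequality is asked for, since the recorded meeting value may exceed the value of its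
    point. *)
Definition records_point s := exists q, [/\ on_graph G q, outputs s q (rmem s best_ 0) &
  ph q <= rmem s best_ 0].

Lemma records_point_agree ims rms s s' : agree ims rms s s' ->
  (3 \notin ims) && (best_ \notin rms) -> records_point s -> records_point s'.
Proof.
move=> [ai ar] /andP[i3 r2] [q [qG [_ oq] pq]]; exists q; rewrite /outputs !ar //.
by split=> //; split=> //; case: q oq {qG pq} => [x|x y t]; rewrite !ai ?ar.
Qed.

Definition env s := [/\ forall a, (a < 3)%N -> imem s a =1 imem s0 a,
  forall a, (a < 2)%N -> rmem s a =1 rmem s0 a &
  forall i, (i <= n)%N -> imem s base_ i = (i * n)%N].

Lemma env_agree ims rms s s' : agree ims rms s s' ->
  all [predC ims] [:: 0; 1; 2; base_]%N && all [predC rms] [:: 0; 1]%N ->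
  env s -> env s'.
Proof.
move=> [ai ar] /andP[/allP im /allP rm] [e1 e2 e3]; split.
- by move=> [|[|[|]]] // lt i; rewrite ai ?e1 //; apply: im.
- by move=> [|[|]] // lt i; rewrite ar ?e2 //; apply: rm.
- by move=> i i_n; rewrite ai ?e3 //; apply: im.
Qed.

(** * The work done on one edge *)

Section Edge.
Variables (e : nat) (u v : 'I_n).
Hypotheses (e_es : (e < size es)%N) (uvE : nth (u, v) es e = (u, v)).
Let l := elength u v.

Lemma edge_joins : joins (edges G) u v.
Proof.
have : [set u; v]%SET \in [seq [set p.1; p.2]%SET | p <- es].
  by apply/mapP; exists (u, v); rewrite // -uvE mem_nth.
by rewrite (perm_mem Ges) mem_enum.
Qed.

Lemma input_edge : [/\ imem s0 1 e = u, imem s0 2 e = v & rmem s0 1 e = l].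
Proof. by rewrite /= !(nth_map (u, v)) // uvE. Qed.

Variables A rA B rB : nat -> nat.
Hypotheses (rkA : ranking n (dist_row u) A rA) (rkB : ranking n (dist_row v) B rB).

Definition edge_env s := [/\ env s, imem s e_ 0 = e,
  imem s urow_ 0 = (u * n)%N /\ imem s vrow_ 0 = (v * n)%N,
  imem s uord_ =1 A /\ imem s urank_ =1 rA &
  imem s vord_ =1 B /\ imem s vrank_ =1 rB].

Lemma edge_env_agree ims rms s s' : agree ims rms s s' ->
  all [predC ims] [:: 0; 1; 2; base_; e_; urow_; vrow_; uord_; urank_; vord_; vrank_]%N &&
  all [predC rms] [:: 0; 1]%N ->
  edge_env s -> edge_env s'.
Proof.
move=> ag /andP[/allP im rm] [en ee [er1 er2] [eA erA] [eB erB]].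
have en' : env s'.
  apply: env_agree ag _ en; rewrite rm andbT; apply/allP => a; rewrite !inE.
  by case/or4P=> /eqP->; apply: im.
have r a i : a \in [:: e_; urow_; vrow_; uord_; urank_; vord_; vrank_]%N ->
    imem s' a i = imem s a i.
  by move=> am; apply: ag.1; apply: im; rewrite !inE in am *; rewrite am !orbT.
by split; rewrite ?r //; split=> [i|i]; rewrite r.
Qed.

Lemma edge_env_denote c s : loop_free c ->
  all [predC imods c] [:: 0; 1; 2; base_; e_; urow_; vrow_; uord_; urank_; vord_; vrank_]%N &&
  all [predC rmods c] [:: 0; 1]%N ->
  edge_env s -> edge_env (denote c s).
Proof. by move=> lf; apply: edge_env_agree; apply: denote_agree. Qed.

Lemma edge_env_reads s : edge_env s ->
  [/\ imem s 0 0 = n, imem s 0 2 = k, imem s 1 e = u, imem s 2 e = v & rmem s 1 e = l].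
Proof.
have [u0 v0 l0] := input_edge.
by case=> [[ei er eb] ee _ _ _]; rewrite !ei // !er.
Qed.

Lemma dist_u_eval s z : edge_env s -> reval s (dist_u z) = dist_row u (A (ieval s z)).
Proof. by case=> [[ei er eb] ee [eu ev] [eA erA] _]; rewrite /= eu eA er. Qed.

Lemma dist_v_eval s z : edge_env s -> reval s (dist_v z) = dist_row v (B (ieval s z)).
Proof. by case=> [[ei er eb] ee [eu ev] _ [eB erB]]; rewrite /= ev eB er. Qed.

Lemma consider_u_spec s : edge_env s -> ((0 < e)%N -> records_point s) ->
  let s' := denote consider_u s in
  [/\ records_point s', rmem s' best_ 0 <= dist_row u (A k.-1) &
      (0 < e)%N -> rmem s' best_ 0 <= rmem s best_ 0].
Proof.
move=> ev gs; have [n1 k1 u1 v1 l1] := edge_env_reads ev.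
have ee : imem s e_ 0 = e by case: ev.
have : reval s (dist_u (pred_exp k_)) = dist_row u (A k.-1).
  by rewrite dist_u_eval //= k1 subn1.
rewrite /consider_u; move: (dist_u _) => z zE.
rewrite /= /update /= zE ee -ltnNge; case: ifP => [H|/negbFE/andP[e0 H]] /=.
  split=> //; last by move=> e0; move: H; rewrite e0 negbK.
  exists (VertexPoint u); rewrite /outputs /= u1; split=> //.
  by rewrite phi_vertex_le -(kth_le rkA).
split=> //; last by rewrite ltW // ltNge.
exact: gs.
Qed.

Lemma consider_v_spec s : edge_env s -> records_point s ->
  let s' := denote consider_v s in
  [/\ records_point s', rmem s' best_ 0 <= dist_row v (B k.-1) &
      rmem s' best_ 0 <= rmem s best_ 0].
Proof.
move=> ev gs; have [n1 k1 u1 v1 l1] := edge_env_reads ev.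
have ee : imem s e_ 0 = e by case: ev.
have : reval s (dist_v (pred_exp k_)) = dist_row v (B k.-1).
  by rewrite dist_v_eval //= k1 subn1.
rewrite /consider_v; move: (dist_v _) => z zE.
rewrite /= /update /= zE; case: ifP => [H|/negbT H] /=.
  split=> //; exists (VertexPoint v); rewrite /outputs /= ?ee v1; split=> //.
  by rewrite phi_vertex_le -(kth_le rkB).
by split=> //; rewrite ltW // ltNge.
Qed.

Let offset i j := meet_offset (dist_row u) (dist_row v) A B l i j.
Let value i j := meet_value (dist_row u) (dist_row v) A B l i j.
Let ucount i j := union_count n rA rB i j.

Lemma consider_meet_spec s i j : edge_env s -> records_point s ->
  imem s i_ 0 = i -> imem s j_ 0 = j -> (0 < i <= n)%N -> (0 < j <= n)%N ->
  (k <= ucount i j)%N ->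
  let s' := denote consider_meet s in
  [/\ records_point s', rmem s' best_ 0 <= rmem s best_ 0 &
     0 < offset i j < l -> rmem s' best_ 0 <= value i j].
Proof.
move=> ev gs Ei Ej i_n j_n kij; have [n1 k1 u1 v1 l1] := edge_env_reads ev.
have ee : imem s e_ 0 = e by case: ev.
pose s1 := denote set_meet_offset s; pose s2 := denote set_meet_value s1.
have ev1 : edge_env s1 by apply: edge_env_denote.
have ev2 : edge_env s2 by apply: edge_env_denote.
have lE s' : edge_env s' -> reval s' len_ = l.
  move=> ev'; have [_ _ _ _ l'] := edge_env_reads ev'.
  by case: ev' => _ ee' _ _ _; rewrite /= ee'.
have uE s' : edge_env s' -> imem s' i_ 0 = i ->
    reval s' (dist_u (pred_exp (ivar i_))) = dist_row u (A i.-1).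
  by move=> ev' Ei'; rewrite dist_u_eval //= Ei' subn1.
have vE s' : edge_env s' -> imem s' j_ 0 = j ->
    reval s' (dist_v (pred_exp (ivar j_))) = dist_row v (B j.-1).
  by move=> ev' Ej'; rewrite dist_v_eval //= Ej' subn1.
have t2 : rmem s2 t_ 0 = offset i j.
  rewrite /offset /meet_offset -(lE s ev) -(uE s ev Ei) -(vE s ev Ej).
  by [].
have val2 : rmem s2 val_ 0 = value i j.
  by rewrite /value /meet_value -(lE s1 ev1) -(uE s1 ev1 Ei) -(vE s1 ev1 Ej).
have best2 : rmem s2 best_ 0 = rmem s best_ 0 by [].
have gs2 : records_point s2 := gs.
have l2 := lE s2 ev2.
have -> : denote consider_meet s = denote output_meet s2 by [].
have [_ _ u2 v2 _] := edge_env_reads ev2.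
have ee2 : imem s2 e_ 0 = e by case: ev2.
move: s2 ev2 t2 val2 best2 gs2 l2 u2 v2 ee2 => s2 ev2 t2 val2 best2 gs2 l2 u2 v2 ee2.
rewrite /output_meet; move: len_ l2 => len l2.
rewrite /= l2 t2 val2 best2 -!ltNge.
case: ifP => [/and3P[t0 tl vb]|H].
  rewrite /update /=; split=> //.
  exists (EdgePoint u v (offset i j)); rewrite /outputs /= ?ee2 u2 v2.
  split; [by split; [exact: edge_joins|rewrite t0]| by [] |].
  rewrite phi_edge_le ?t0 //; last exact: edge_joins.
  exact: (meet_value_count _ rkA rkB i_n j_n kij).
split=> [//||/andP[t0 tl]]; first by rewrite best2.
by move: H; rewrite t0 tl best2 /= => /negbT; rewrite -ltNge => /ltW.
Qed.

Definition scan_bound := (cost (set_ivar i_ n_) * 3 +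
  (cost scan_step + bcost (ilt (IConst 0) (ivar j_))).+1 * (n + n).+1)%N.

(** Invariant: a pair whose union holds k vertices either still lies in the region to be swept, with
    first index at least the current i and second at most the current j, or dominates an examined
    pair. When the loop ends j is 0, and the first alternative is void. *)
Lemma scan_runs s : edge_env s -> records_point s ->
  runs scan s scan_bound (fun s' => [/\ records_point s', rmem s' best_ 0 <= rmem s best_ 0 &
    forall i j, (i <= n)%N -> (0 < j <= n)%N -> (k <= ucount i j)%N ->
     exists i' j', [/\ (i' <= i)%N, (0 < j' <= j)%N, (k <= ucount i' j')%N &
       (0 < i')%N -> 0 < offset i' j' < l -> rmem s' best_ 0 <= value i' j']]).
Proof.
move=> ev gs; have n0 : imem s 0 0 = n by case: (edge_env_reads ev).
pose I s' := [/\ records_point s', rmem s' best_ 0 <= rmem s best_ 0,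
  (imem s' i_ 0 <= n)%N /\ (imem s' j_ 0 <= n)%N,
  imem s' c_ 0 = ucount (imem s' i_ 0) (imem s' j_ 0) &
  forall i j, (i <= n)%N -> (0 < j <= n)%N -> (k <= ucount i j)%N ->
    (imem s' i_ 0 <= i)%N /\ (j <= imem s' j_ 0)%N \/
     exists i' j', [/\ (i' <= i)%N, (0 < j' <= j)%N, (k <= ucount i' j')%N &
       (0 < i')%N -> 0 < offset i' j' < l -> rmem s' best_ 0 <= value i' j']].
apply: (runs_weaken (T := cost (set_ivar i_ (IConst 0)) +
  (cost (set_ivar j_ n_) + (cost (set_ivar c_ n_) +
  (cost scan_step + bcost (ilt (IConst 0) (ivar j_))).+1 * (n + n).+1)))).
- do 3![apply: runs_seq_loop_free => //].
  set s1 := denote _ _.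
  have mu1 : (n - imem s1 i_ 0 + imem s1 j_ 0 = n + n)%N by rewrite /= /update /= n0 subn0.
  rewrite -[in X in runs _ _ X]mu1.
  (* Each step raises i or lowers j, hence at most 2n steps. *)
  apply: (runs_while (mu := fun s' => (n - imem s' i_ 0 + imem s' j_ 0)%N) (I := I)).
    rewrite /I /= /update /= n0; split=> //; first by rewrite /ucount (union_count_0l _ rkB).
    by move=> i j _ /andP[_ jn] _; left.
  move=> s2 a2 [gs2 b2 [i_n j_n] Ec H] jpos.
  have ev1 : edge_env s1 by do 3![apply: edge_env_denote => //].
  have ev2 : edge_env s2 by apply: edge_env_agree a2 _ ev1.
  have [_ k2 _ _ _] := edge_env_reads ev2.
  apply: runs_loop_free => //.
  have -> : denote scan_step s2 = if beval s2 (BILe k_ (ivar c_)) then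
      denote shrink_j
        (if beval s2 (ilt (IConst 0) (ivar i_)) then denote consider_meet s2 else s2)
    else denote grow_i s2 by [].
  set s3 := if _ then denote consider_meet s2 else s2.
  move: {a2 jpos} (jpos : ~~ (imem s2 j_ 0 <= 0)%N); rewrite -ltnNge => j0.
  have -> : beval s2 (BILe k_ (ivar c_)) = (k <= imem s2 c_ 0)%N by rewrite /= k2.
  case: ifPn => [kc|kc].
    have a3 : agree (imods consider_meet) (rmods consider_meet) s2 s3.
      by rewrite /s3; case: ifP => _; [apply: denote_agree|].
    have ev3 : edge_env s3 by apply: edge_env_agree a3 _ ev2.
    rewrite Ec in kc.
    have [gs3 b3 v3] : [/\ records_point s3, rmem s3 best_ 0 <= rmem s2 best_ 0 &
        (0 < imem s2 i_ 0)%N -> 0 < offset (imem s2 i_ 0) (imem s2 j_ 0) < l ->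
        rmem s3 best_ 0 <= value (imem s2 i_ 0) (imem s2 j_ 0)].
      rewrite /s3; case: ifPn => /= [|/negPn]; last by split=> //; lia.
      move=> ipos; have [||gs3 b3 v3] := consider_meet_spec ev2 gs2 erefl erefl _ _ kc; try lia.
      by split.
    have i3 : imem s3 i_ 0 = imem s2 i_ 0 by rewrite a3.1.
    have j3 : imem s3 j_ 0 = imem s2 j_ 0 by rewrite a3.1.
    have c3 : imem s3 c_ 0 = imem s2 c_ 0 by rewrite a3.1.
    move: i3 j3 c3 gs3 b3 v3 ev3; clearbody s3; clear a3 => i3 j3 c3 gs3 b3 v3 ev3.
    have [_ _ _ [_ rA3] [vord3 _]] := ev3.
    pose j' := (imem s2 j_ 0).-1.
    have jE : imem s2 j_ 0 = j'.+1 by rewrite /j' prednK.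
    have j'n : (j' < n)%N by rewrite -jE.
    rewrite jE in j3 Ec kc v3 *.
    rewrite [ucount _ _](union_count_Sr _ rkB) // -/(ucount _ _) in Ec.
    have a4 := denote_agree s3 (isT : loop_free shrink_j).
    have j4 : imem (denote shrink_j s3) j_ 0 = j'.
      by rewrite /= /update /= j3 subn1 /=; case: ifP.
    have c4 : imem (denote shrink_j s3) c_ 0 = ucount (imem s2 i_ 0) j'.
      rewrite /= /update /= j3 subn1 /= vord3 rA3 i3.
      by case: ifP => le; rewrite le in Ec; rewrite /= c3 Ec ?addn0 // addn1 subn1.
    have i4 : imem (denote shrink_j s3) i_ 0 = imem s2 i_ 0 by rewrite a4.1.
    have best4 : rmem (denote shrink_j s3) best_ 0 = rmem s3 best_ 0 by rewrite a4.2.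
    have gs4 : records_point (denote shrink_j s3) by apply: records_point_agree a4 _ gs3.
    move: (denote shrink_j s3) j4 c4 i4 best4 gs4 {a4} => s4 j4 c4 i4 best4 gs4.
    rewrite /I i4 j4 best4; split; last lia.
    split=> //; [exact: le_trans b2|by split=> //; apply: ltnW|].
    move=> i j ile jn kij; have [[ii jj]|[i' [j'' [ii jj kk vv]]]] := H i j ile jn kij.
      (* Pairs lost by lowering j dominate the pair just examined. *)
      have [jE'|jne] := eqVneq j j'.+1; last by left; lia.
      by right; exists (imem s2 i_ 0), j'.+1; rewrite jE' leqnn; split.
    right; exists i', j''; split=> // i'0 val; exact: le_trans b3 (vv i'0 val).
  rewrite Ec -ltnNge in kc.
  (* The full first prefix has n vertices, at least k, so i never grows beyond n. *)
  have lt_i : (imem s2 i_ 0 < n)%N.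
    rewrite ltn_neqAle i_n andbT; apply/eqP => E; move: kc.
    by rewrite E [ucount _ _](union_count_nl _ rkA) ltnNge; case/andP: kn => _ ->.
  have [_ _ _ [uord2 _] [_ rB2]] := ev2.
  have a4 := denote_agree s2 (isT : loop_free grow_i).
  have j4 : imem (denote grow_i s2) j_ 0 = imem s2 j_ 0 by rewrite a4.1.
  have i4 : imem (denote grow_i s2) i_ 0 = (imem s2 i_ 0).+1.
    by rewrite /= /update /=; case: ifP; rewrite addn1.
  have c4 : imem (denote grow_i s2) c_ 0 = ucount (imem s2 i_ 0).+1 (imem s2 j_ 0).
    rewrite [ucount _ _](union_count_Sl _ rkA) // -/(ucount _ _) -Ec /= /update /= uord2 rB2.
    by case: ifP => _; rewrite ?addn0.
  have best4 : rmem (denote grow_i s2) best_ 0 = rmem s2 best_ 0 by rewrite a4.2.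
  have gs4 : records_point (denote grow_i s2) by apply: records_point_agree a4 _ gs2.
  move: (denote grow_i s2) j4 c4 i4 best4 gs4 {a4} => s4 j4 c4 i4 best4 gs4.
  rewrite /I i4 j4 best4; split; last lia.
  split=> // i j ile jn kij; have [[ii jj]|] := H i j ile jn kij; last by right.
  (* By monotonicity a pair lost by raising i would give the current pair k vertices, which the test
     has refuted. *)
  left; split=> //; rewrite ltn_neqAle ii andbT; apply/eqP => E.
  by move: kc; rewrite E ltnNge (leq_trans kij) // leq_union_count.
- by rewrite !addnA leq_add2r.
- move=> s' _ [_ [gs' b' _ _ H] /negPn jz]; split=> // i j ile jn kij.
  case: (H i j ile jn kij) => // -[_]; move: jz; rewrite /= leqn0 => /eqP ->.
  by case/andP: jn; case: j {kij}.
Qed.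

End Edge.

(** * From single edges to the whole graph *)

Definition on_edge u v (q : graph_point R 'I_n) : Prop :=
  match q with
  | VertexPoint x => x = u \/ x = v
  | EdgePoint x y _ => [set x; y]%SET = [set u; v]%SET
  end.

Definition edge_bound := (C * (n.+1 * (trunc_log 2 n).+1) +
  (C * (n.+1 * (trunc_log 2 n).+1) +
  (cost consider_u + (cost consider_v + (scan_bound + cost (incr e_))))))%N.

Lemma process_edge_runs s e u v : (e < size es)%N -> nth (u, v) es e = (u, v) ->
  env s -> imem s e_ 0 = e -> ((0 < e)%N -> records_point s) ->
  runs process_edge s edge_bound (fun s' =>
   [/\ env s', imem s' e_ 0 = e.+1, records_point s',
     (0 < e)%N -> rmem s' best_ 0 <= rmem s best_ 0 &
     forall q, on_graph G q -> on_edge u v q -> rmem s' best_ 0 <= ph q]).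
Proof.
move=> e_es uvE ev ee gs; have n_gt0 : (0 < n)%N by case/andP: kn; apply: leq_trans.
have env_n s' : env s' -> imem s' 0 0 = n by case=> ->.
have [u0 v0 l0] := input_edge e_es uvE.
have row_eq s' x r : env s' -> r = (x * n)%N ->
    (fun y => rmem s' 0 (r + y)) = dist_row x.
  by move=> [_ er _] ->; apply/boolp.funext => y; rewrite er.
have bu : imem s base_ (ieval s u_) = (u * n)%N.
  by case: ev => [ei _ eb] /=; rewrite (ei 1%N) // ee u0 eb // ltnW.
have run_u := @rank_runs s n u_ urow_ uord_ urank_ isT (env_n s ev) n_gt0 isT.
apply: runs_seq; apply: (runs_weaken run_u (leqnn _)).
move=> s1 a1 [r1 rkA]; rewrite (row_eq s u) // in rkA; last by rewrite r1.
have ev1 : env s1 by apply: env_agree a1 _ ev.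
have ee1 : imem s1 e_ 0 = e by rewrite a1.1.
have bv : imem s1 base_ (ieval s1 v_) = (v * n)%N.
  by case: ev1 => [ei _ eb] /=; rewrite (ei 2%N) // ee1 v0 eb // ltnW.
have run_v := @rank_runs s1 n v_ vrow_ vord_ vrank_ isT (env_n s1 ev1) n_gt0 isT.
apply: runs_seq; apply: (runs_weaken run_v (leqnn _)).
move=> s2 a2 [r2 rkB]; rewrite (row_eq s1 v) // in rkB; last by rewrite r2.
pose A := imem s1 uord_; pose rA := imem s1 urank_.
pose B := imem s2 vord_; pose rB := imem s2 vrank_.
have ev2 : edge_env e u v A rA B rB s2.
  split; first exact: env_agree a2 _ ev1.
  - by rewrite a2.1.
  - by rewrite a2.1 // r1 r2.
  - by split=> i; rewrite a2.1.
  - by [].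
have gs2 : (0 < e)%N -> records_point s2.
  by move=> e0; apply: records_point_agree a2 _ (records_point_agree a1 _ (gs e0)).
have best2 : rmem s2 best_ 0 = rmem s best_ 0 by rewrite a2.2 // a1.2.
have [gs3 best3u best3] := consider_u_spec e_es uvE rkA ev2 gs2.
apply: runs_seq_loop_free => //.
have ev3 : edge_env e u v A rA B rB (denote consider_u s2) by apply: edge_env_denote ev2.
move: (denote consider_u s2) gs3 best3u best3 ev3 => s3 gs3 best3u best3 ev3.
have [gs4 best4v best4] := consider_v_spec e_es uvE rkB ev3 gs3.
apply: runs_seq_loop_free => //.
have ev4 : edge_env e u v A rA B rB (denote consider_v s3) by apply: edge_env_denote ev3.
move: (denote consider_v s3) gs4 best4v best4 ev4 => s4 gs4 best4v best4 ev4.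
apply: runs_seq; apply: (runs_weaken (scan_runs e_es uvE rkA rkB ev4 gs4) (leqnn _)).
move=> s5 a5 [gs5 best5 cover]; apply: runs_loop_free => //.
have ag6 := denote_agree s5 (isT : loop_free (incr e_)).
have ev5 : env s5 by case: ev4 => ev4 _ _ _ _; apply: env_agree a5 _ ev4.
split.
- exact: env_agree ag6 _ ev5.
- by rewrite /= /update /= a5.1 // addn1; case: ev4 => _ -> _ _ _.
- exact: records_point_agree ag6 _ gs5.
- by move=> e0; rewrite /= -best2; apply: le_trans best5 (le_trans best4 (best3 e0)).
have uv := edge_joins e_es uvE.
have best_u : rmem s5 best_ 0 <= dist_row u (A k.-1).
  exact: le_trans best5 (le_trans best4 best3u).
have best_v : rmem s5 best_ 0 <= dist_row v (B k.-1) by apply: le_trans best5 best4v.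
have via_uv t : 0 < t < elength u v -> rmem s5 best_ 0 <= ph (EdgePoint u v t).
  move=> tl; have := lexx (ph (EdgePoint u v t)); rewrite phi_edge_le //.
  apply: (best_le rkA rkB _ _ kn best_u best_v cover tl) => y yn.
    have := dist_edge_l Gs Gc (Ordinal yn) uv; by rewrite -!dist_rowE.
  have vu : joins (edges G) v u by rewrite joins_sym.
  have := dist_edge_l Gs Gc (Ordinal yn) vu; rewrite -!dist_rowE.
  by rewrite finset.setUC.
case=> [x _ [->|->]|x y t [xy tl] /eq_set2[[xu yv]|[xv yu]]].
- apply: le_trans best_u _; rewrite (kth_le rkA) // -phi_vertex_le; exact: lexx.
- apply: le_trans best_v _; rewrite (kth_le rkB) // -phi_vertex_le; exact: lexx.
- by subst x y; apply: via_uv.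
- subst x y; have lE : elen G [set v; u]%SET = elength u v by rewrite finset.setUC.
  rewrite lE in tl; have tl' : 0 < elength u v - t < elength u v.
    by case/andP: tl => *; apply/andP; split; lra.
  have := via_uv _ tl'; rewrite -phi_edge_sym // subKr.
  exact.
Qed.

Lemma size_es : size es = #|edges G|.
Proof. by have := perm_size Ges; rewrite size_map -cardE. Qed.

Lemma phi_ge0 q : on_graph G q -> 0 <= ph q.
Proof.
move=> qG; have := lexx (ph q); rewrite {1}/ph phi_le ?card_ord // => le.
have /card_gt0P[y] := leq_trans (proj1 (andP kn)) le; rewrite inE.
exact/le_trans/point_dist_ge0.
Qed.

Lemma points_covered q : on_graph G q -> (0 < size es)%N ->
  exists2 p, p \in es & on_edge p.1 p.2 q.
Proof.
have edge_of x y : joins (edges G) x y ->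
    exists2 p, p \in es & [set x; y]%SET = [set p.1; p.2]%SET.
  by rewrite /joins -mem_enum -(perm_mem Ges) => /mapP[p pes ->]; exists p.
case: q => [x|x y t] /= qG es0; last by case: qG => /edge_of.
(* An edge has two ends, so a second vertex exists; the first edge of a walk from x towards it
   contains x. *)
have [z xz] : exists z, z != x.
  case: es es0 Ges => // -[a b] r _ /perm_mem/(_ [set a; b]%SET).
  rewrite mem_head mem_enum => /esym/(joins_neq Gs) ab.
  by have [ax|] := eqVneq a x; [exists b; rewrite -ax eq_sym|exists a].
have /connectP[[|y r] /=] := Gc x z; first by move=> _ zx; rewrite zx eqxx in xz.
case/andP=> /edge_of[p pes xyE] _ _; exists p => //.
by apply/set2P; rewrite -xyE set21.
Qed.
End Edges.

Lemma no_edge_vertices (R : realType) (V : finType) (G : wgraph R V) :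
  connected_graph G -> edges G = finset.set0 -> forall x y : V, x = y.
Proof.
move=> Gc G0 x y; have /connectP[[|z r] //= /andP[]] := Gc x y.
by rewrite /joins G0 inE.
Qed.

(** For n > 1 there is an edge and the logarithm is positive, so n + 1, log n + 1 and m + 1 are at
    most twice n, log n and m: this gives the 8. The 2 before [C1] is n + 1 for n = 1. *)
Lemma total_time C1 C2 K0 K1 b n m :
  0 < n -> (n == 1) || (0 < m) -> (n == 1) ==> (m == 0) ->
  C1 * n.+1 + (C2 * (n.+1 * (trunc_log 2 n).+1) + (C2 * (n.+1 * (trunc_log 2 n).+1) +
    (K0 + K1 * (n + n).+1)) + b).+1 * m.+1 <=
  (2 * C1 + 8 * (2 * C2 + K0 + 3 * K1 + b).+1) * (m * n * trunc_log 2 n).+1.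
Proof.
move=> n0; have [-> _ /= /eqP->|n1 /= m0 _] := eqVneq n 1.
  rewrite trunc_log1; lia.
have n2 : 1 < n by lia.
have log0 : 0 < trunc_log 2 n by rewrite trunc_log_gt0.
move: (trunc_log 2 n) log0 => L L0; set D := 2 * C2 + K0 + 3 * K1 + b.
have nX : n <= m * n * L by rewrite -{1}(muln1 n) (mulnC m) -mulnA leq_mul // muln_gt0 m0.
have le1 : C2 * (n.+1 * L.+1) + (C2 * (n.+1 * L.+1) + (K0 + K1 * (n + n).+1)) + b <
    D.+1 * (n.+1 * L.+1).
  have : n.+1 <= n.+1 * L.+1 by rewrite leq_pmulr.
  rewrite /D; move: (n.+1 * L.+1) => N; nia.
have le2 : n.+1 * L.+1 <= 4 * (n * L) by nia.
have le3 : (n.+1 * L.+1) * m.+1 <= 8 * (m * n * L).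
  apply: leq_trans (leq_mul le2 (_ : m.+1 <= 2 * m)) _; first lia.
  by rewrite (_ : 4 * (n * L) * (2 * m) = 8 * (m * n * L)) //; ring.
apply: leq_trans (leq_add (leqnn _) (leq_mul le1 (leqnn m.+1))) _.
rewrite -mulnA; apply: leq_trans (leq_add (leqnn _) (leq_mul (leqnn D.+1) le3)) _.
move: (m * n * L) nX => X nX; nia.
Qed.

Theorem theorem2 (R : realType) :
  exists (P : cmd) (C : nat),
  forall (n k : nat) (G : wgraph R 'I_n) (es : seq ('I_n * 'I_n)),
    simple_graph G -> connected_graph G -> edge_list G es ->
    (0 < k)%N -> (k <= n)%N ->
    exists (s : state R) (time : nat) (x : graph_point R 'I_n),
      [/\ exec P (input G k es) s time,
          (time <= C * (#|edges G| * n * trunc_log 2 n).+1)%N,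
          partial_center G (fun _ : 'I_n => 1%R) k x
        & outputs s x (phi G (fun _ : 'I_n => 1%R) k x)].
Proof.
have [C1 base_runs] := fill_base_runs R; have [C2 rank_runs] := rank_row_runs R.
set b := bcost (ilt (ivar e_) (IGet 0 (IConst 1))).
set K1 := (cost scan_step + bcost (ilt (IConst 0) (ivar j_))).+1.
set K0 := cost consider_u + (cost consider_v + (cost (set_ivar i_ n_) * 3 + cost (incr e_))).
exists center_program, (2 * C1 + 8 * (2 * C2 + K0 + 3 * K1 + b).+1).
move=> n k G es Gs Gc Ges k0 kn; have kn' : 0 < k <= n by rewrite k0.
have n0 : 0 < n by apply: leq_trans kn.
set s0 := input G k es; set ph := phi G _ k.
have size_es := size_es Ges.
pose I s := [/\ env k G es s, imem s e_ 0 <= size es,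
  0 < imem s e_ 0 -> records_point k G s,
  (* For a graph without edges the initial zeros are the answer: vertex 0 with value 0. *)
  imem s e_ 0 = 0 -> imem s 3 =1 imem s0 3 /\ rmem s 2 =1 rmem s0 2 &
  forall e d q, e < imem s e_ 0 -> on_graph G q ->
    on_edge (nth d es e).1 (nth d es e).2 q -> (rmem s best_ 0 <= ph q)%R].
have : runs center_program s0 (C1 * n.+1 + (edge_bound n C2 + b).+1 * (size es).+1)
    (fun s => I s /\ imem s e_ 0 = size es).
  apply: runs_seq; apply: (runs_weaken (base_runs s0 n erefl erefl) (leqnn _)) => s1 a1 base1.
  have e1 : imem s1 e_ 0 = 0 by rewrite a1.1.
  apply: (runs_weaken (T := (edge_bound n C2 + b).+1 * (size es - imem s1 e_ 0).+1)).
  - apply: (runs_while (mu := fun s => size es - imem s e_ 0) (I := I)).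
      split; rewrite ?e1 //.
        split=> [a a3 i|a a2 i|//]; last by rewrite a1.2.
        by rewrite a1.1 //; case: a a3 => [|[|[|]]].
      by move=> _; split=> i; [rewrite a1.1|rewrite a1.2].
    move=> s2 _ [ev2 le2 gs2 _ cov2] b2.
    have lt2 : imem s2 e_ 0 < size es.
      by move: b2; case: ev2 => ei _ _; rewrite /= (ei 0) // -ltnNge size_es.
    pose d0 := (Ordinal n0, Ordinal n0); set e := imem s2 e_ 0 in lt2 gs2 cov2 *.
    have pE d : nth d es e = ((nth d0 es e).1, (nth d0 es e).2).
      by rewrite -surjective_pairing; apply: set_nth_default.
    have run_e := process_edge_runs Gs Gc Ges kn' rank_runs lt2 (pE _) ev2 erefl gs2.
    apply: (runs_weaken run_e (leqnn _)) => s3 a3 [ev3 e3 gs3 best3 cov3].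
    rewrite e3; split; last by lia.
    split; rewrite ?e3 // => e' d q; rewrite ltnS leq_eqVlt => /orP[/eqP->|lt] qG.
      by rewrite pE; apply: cov3.
    move=> qe; apply: le_trans (cov2 e' d q lt qG qe); apply: best3.
    exact: leq_trans lt.
  - by rewrite e1 subn0.
  - move=> s' _ [_ Is' b']; split=> //; case: Is' => [[ei _ _] le _ _ _].
    by apply/eqP; rewrite eqn_leq le; move: b'; rewrite /= (ei 0) // negbK size_es.
move=> [s [t [run_s t_le [[_ _ gs out0 cov] eE]]]]; rewrite eE in gs out0 cov.
have edgeless : size es = 0 -> n = 1.
  move=> /eqP; rewrite size_es cards_eq0 => /eqP G0.
  apply/eqP; rewrite eqn_leq n0 andbT leqNgt; apply/negP => n1.
  by have /(congr1 val) := no_edge_vertices Gc G0 (Ordinal n0) (Ordinal n1).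
have time_le : t <= (2 * C1 + 8 * (2 * C2 + K0 + 3 * K1 + b).+1) *
    (#|edges G| * n * trunc_log 2 n).+1.
  apply: leq_trans t_le _; rewrite -size_es.
  apply: leq_trans (total_time C1 C2 K0 K1 b n0 _ _).
  - rewrite /edge_bound /scan_bound -/K1 /K0 leq_add2l leq_mul2r ltnS leq_add2r; apply/orP; right.
    lia.
  - by have [es0|es0] := posnP (size es); rewrite ?orbT // (edgeless es0) eqxx.
  - apply/implyP => /eqP n1; rewrite size_es cards_eq0 -subset0; apply/fintype.subsetP => f fG.
    by have [f2 _] := Gs _ fG; have := max_card (mem f); rewrite card_ord f2; lia.
have [es0|es_gt0] := posnP (size es).
  have n1 := edgeless es0.
  have G0 : edges G = finset.set0 by apply/eqP; rewrite -cards_eq0 -size_es es0.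
  have same := no_edge_vertices Gc G0.
  pose x := VertexPoint (Ordinal n0) : graph_point R 'I_n.
  have [out3 best0] := out0 es0.
  have ph0 : ph x = 0%R.
    apply/le_anti/andP; split; last exact: phi_ge0.
    rewrite /ph phi_le ?card_ord //; apply: leq_trans kn _.
    rewrite -{1}(card_ord n) -cardsT subset_leq_card //; apply/fintype.subsetP => y _.
    by rewrite inE /= (same y (Ordinal n0)) dist_refl.
  exists s, t, x; split=> //.
    split=> // -[y _|y z u []]; first by rewrite (same y (Ordinal n0)).
    by rewrite G0 inE.
  by rewrite /outputs -/ph ph0 out3 out3 best0.
have [x [xG ox phx]] := gs es_gt0.
have best_le y : on_graph G y -> (rmem s best_ 0 <= ph y)%R.
  move=> yG; have [p pes yp] := points_covered Gs Gc Ges yG es_gt0.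
  by apply: (cov (index p es) p); rewrite ?index_mem ?nth_index.
exists s, t, x; split=> //.
  by split=> // y yG; apply: le_trans phx (best_le y yG).
(* The recorded number is also a lower bound for the value of the recorded point itself, which
   forces equality. *)
by have <- : rmem s best_ 0 = ph x by apply/le_anti; rewrite phx best_le.
Qed.
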